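(* Let $(V,Q)$ be a nontrivial, finite dimensional quadratic space over $\mathbb{F}_2$, with associated alternating form $f$, and let $\mathbb{F}$ be a field of characteristic $\neq2$. Let $n=\dim(V/\mathrm{Rad}(Q))$, $r=\dim\mathrm{Rad}(f)$, and let $\overline{Q}$ be the form induced by $Q$ on $\overline{V}=V/\mathrm{Rad}(Q)$. Then the isomorphism type of the special quasi-Clifford algebra $\mathfrak{C}(V,Q)$ over $\mathbb{F}$ is as follows. - $\mathbb{F}$ of type I: if $n$ is even and $\overline{Q}$ is of $+$-type or of $-$-type: $\bigl(M(2,\mathbb{F})^{\otimes\frac n2}\bigr)^{2^r}$; if $n$ is odd and $\overline{Q}$ is of $0$-type: $\bigl(M(2,\mathbb{F})^{\otimes\frac{n-1}2}\bigr)^{2^r}$. - $\mathbb{F}$ of type II: if $n$ is even and $\overline{Q}$ is of $+$-type or of $-$-type: $\bigl(M(2,\mathbb{F})^{\otimes\frac n2}\bigr)^{2^r}$; if $n$ is odd and $\overline{Q}$ is of $0$-type: $\bigl(M(2,\mathbb{F})^{\otimes\frac{n-1}2}\otimes\mathbb{F}[i]\bigr)^{2^{r-1}}$. - $\mathbb{F}$ of type III: if $n$ is even and $\overline{Q}$ is of $+$-type: $\bigl(M(2,\mathbb{F})^{\otimes\frac n2}\bigr)^{2^r}$; if $n$ is even and $\overline{Q}$ is of $-$-type: $\bigl(M(2,\mathbb{F})^{\otimes\frac{n-2}2}\otimes\mathbb{H}\bigr)^{2^r}$; if $n$ is odd and $\overline{Q}$ is of $0$-type: $\bigl(M(2,\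mathbb{F})^{\otimes\frac{n-1}2}\otimes\mathbb{F}[i]\bigr)^{2^{r-1}}$.
   Context: A quadratic space $(V,Q)$ over $\mathbb{F}_2$ is an $\mathbb{F}_2$-space $V$ (addition $\oplus$) with a quadratic form $Q$; the associated alternating form is $f(v,w)=Q(v\oplus w)+Q(v)+Q(w)$. It is nontrivial if $V\neq0$. $\mathrm{Rad}(f)=\{v\mid f(v,w)=0\ \forall w\in V\}$, $\mathrm{Rad}(Q)=\{v\in\mathrm{Rad}(f)\mid Q(v)=0\}$. Types: in dimension $1$ the form $x\mapsto x^2$ is of $0$-type; in dimension $2$, $x_1x_2$ is of $+$-type and $x_1^2+x_1x_2+x_2^2$ is of $-$-type. In general $Q$ is of $+$-type if $V=V_1\perp\cdots\perp V_k\perp\mathrm{Rad}(Q)$ with all $V_i$ $2$-dimensional of $+$-type ($k=0$ allowed); of $-$-type if the same holds except that exactly one $V_i$ is $2$-dimensional of $-$-type; of $0$-type if the same holds except that exactly one $V_i$ is $1$-dimensional of $0$-type. Every finite dimensional $(V,Q)$ has exactly one type. $\mathfrak{C}(V,Q)$: for any basis $\mathcal{V}$ of $V$, the associative unital $\mathbb{F}$-algebra generated by $\mathcal{V}$ with relations $v^2=(-1)^{Q(v)}\mathbf{1}$ and $vw=(-1)^{f(v,w)}wv$ for distinct $v,w\in\mathcal{V}$; up to isomorphism it is independent of the basis. A field $\mathbb{F}$ is of type I if some $i\in\mathbb{F}$ has $i^2=-1$; of type II if there is no such $i$ but there are $x,y\in\mathbb{F}$ with $x^2+y^2=-1$; of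 type III if there are no $x,y\in\mathbb{F}$ with $x^2+y^2=-1$. For types II and III, $\mathbb{F}[i]$ is the quadratic extension with $i^2=-1$. $M(2,\mathbb{F})$ is the algebra of $2\times2$ matrices; $\mathbb{H}$ is the quaternion algebra over $\mathbb{F}$ generated by $v,w$ with $v^2=w^2=-\mathbf{1}$, $vw=-wv$. Tensor products are over $\mathbb{F}$, $B^{\otimes0}=\mathbb{F}$, and $B^m$ denotes the direct product of $m$ copies of the algebra $B$. *)

(* Defs.v *)
From HB Require Import structures.
From mathcomp Require Import all_boot all_order all_algebra finfield.
From mathcomp Require Import boolp.
From mathcomp Require Import finmap monalg.

Set Implicit Arguments.
Unset Strict Implicit.
Unset Printing Implicit Defensive.

Import GRing.Theory.
Local Open Scope ring_scope.
Local Open Scope quotient_scope.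

(* An associative unital F-algebra, presented as a ring with a ring morphism
   from F to its centre: the scaling a . x is [alg_map a * x].  MathComp's
   [algType] is not used because it demands 1 != 0, which is not available
   beforehand for an algebra given by generators and relations. *)
HB.mixin Record isPzAlgebra (F : fieldType) A of GRing.PzRing A := {
  alg_map : {rmorphism F -> A};
  alg_mapC : forall (a : F) (x : A), alg_map a * x = x * alg_map a
}.

#[short(type="pzAlgType")]
HB.structure Definition PzAlgebra (F : fieldType) :=
  {A of GRing.PzRing A & isPzAlgebra F A}.

Definition alg_isom (F : fieldType) (A B : pzAlgType F) : Prop :=
  exists f : {rmorphism A -> B},
    bijective f /\ forall a : F, f (alg_map a) = alg_map a.

HB.instance Definition _ (F : fieldType) :=
  @isPzAlgebra.Build F F idfun (@mulrC F).

HB.instance Definition _ (F : fieldType) n :=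
  @isPzAlgebra.Build F 'M[F]_n (@scalar_mx F n)
    (fun a x => esym (scalar_mxC a x)).

HB.instance Definition _ (F : fieldType) (p : {poly F}) :=
  @isPzAlgebra.Build F {poly %/ p} (qpolyC p) (fun a x => mulrC _ x).

Section DirectPower.

Variables (F : fieldType) (I : finType) (A : pzAlgType F).

Definition ffun_const (a : F) : {ffun I -> A} := [ffun => alg_map a].

Fact ffun_const_zmod : zmod_morphism ffun_const.
Proof. by move=> a b; apply/ffunP=> i; rewrite !ffunE rmorphB. Qed.

Fact ffun_const_monoid : monoid_morphism ffun_const.
Proof.
by split=> [|a b]; apply/ffunP=> i; rewrite !ffunE ?rmorph1 ?rmorphM.
Qed.

HB.instance Definition _ :=
  GRing.isZmodMorphism.Build F {ffun I -> A} ffun_const ffun_const_zmod.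
HB.instance Definition _ :=
  GRing.isMonoidMorphism.Build F {ffun I -> A} ffun_const ffun_const_monoid.

Fact ffun_constC a (f : {ffun I -> A}) : ffun_const a * f = f * ffun_const a.
Proof. by apply/ffunP=> i; rewrite !ffunE alg_mapC. Qed.

HB.instance Definition _ :=
  @isPzAlgebra.Build F {ffun I -> A} ffun_const ffun_constC.

End DirectPower.


Section AlgebraQuotient.

Variables (F : fieldType) (A : pzAlgType F) (S : A -> Prop).

Inductive ideal_gen : A -> Prop :=
| ideal_gen_rel x of S x : ideal_gen x
| ideal_gen0 : ideal_gen 0
| ideal_genB x y of ideal_gen x & ideal_gen y : ideal_gen (x - y)
| ideal_genMl a x of ideal_gen x : ideal_gen (a * x)
| ideal_genMr a x of ideal_gen x : ideal_gen (x * a).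

Definition in_ideal : pred A := fun x => `[< ideal_gen x >].

Fact in_ideal_zmod : zmod_closed in_ideal.
Proof.
split=> [|x y]; first by apply/asboolP; exact: ideal_gen0.
by move=> /asboolP hx /asboolP hy; apply/asboolP; exact: ideal_genB.
Qed.

HB.instance Definition _ := GRing.isZmodClosed.Build A in_ideal in_ideal_zmod.

Definition alg_quot := Quotient.quot (GRing.ZmodClosed.clone A in_ideal _).

HB.instance Definition _ := GRing.Zmodule.on alg_quot.

Definition alg_pi : A -> alg_quot := \pi_alg_quot.
Local Notation pi := alg_pi.

Lemma alg_piK : cancel (repr : alg_quot -> A) pi.
Proof. exact: reprK. Qed.

Lemma alg_pi_eqP x y : reflect (ideal_gen (x - y)) (pi x == pi y).
Proof. by rewrite -Quotient.idealrBE; exact: asboolP. Qed.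

Fact alg_pi_zmod : zmod_morphism pi.
Proof. by move=> x y; rewrite /pi !piE. Qed.

HB.instance Definition _ :=
  GRing.isZmodMorphism.Build A alg_quot pi alg_pi_zmod.

Definition alg_quot_mul (x y : alg_quot) : alg_quot := pi (repr x * repr y).

Lemma alg_quot_mulE x y : alg_quot_mul (pi x) (pi y) = pi (x * y).
Proof.
have h z : ideal_gen (repr (pi z) - z) by apply/alg_pi_eqP; rewrite alg_piK.
apply/eqP/alg_pi_eqP.
set x' := repr _; set y' := repr _.
have -> : x' * y' - x * y = (x' - x) * y' - x * (y - y').
  by rewrite mulrBl mulrBr opprB addrA subrK.
apply: ideal_genB; first by apply: ideal_genMr; exact: h.
apply: ideal_genMl; rewrite -opprB -sub0r.
by apply: ideal_genB; [exact: ideal_gen0 | exact: h].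
Qed.

Fact alg_quot_mulA : associative alg_quot_mul.
Proof.
move=> x y z; rewrite -[x]alg_piK -[y]alg_piK -[z]alg_piK.
rewrite (alg_quot_mulE (repr y) (repr z)) (alg_quot_mulE (repr x) (repr y)).
by rewrite (alg_quot_mulE _ (repr z)) (alg_quot_mulE (repr x)) mulrA.
Qed.

Fact alg_quot_mul1 : left_id (pi 1) alg_quot_mul.
Proof. by move=> x; rewrite -[x]alg_piK alg_quot_mulE mul1r. Qed.

Fact alg_quot_mulr1 : right_id (pi 1) alg_quot_mul.
Proof. by move=> x; rewrite -[x]alg_piK alg_quot_mulE mulr1. Qed.

Fact alg_quot_mulDl : left_distributive alg_quot_mul +%R.
Proof.
move=> x y z; rewrite -[x]alg_piK -[y]alg_piK -[z]alg_piK -raddfD.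
by rewrite (alg_quot_mulE (_ + _)) !(alg_quot_mulE (repr _)) mulrDl raddfD.
Qed.

Fact alg_quot_mulDr : right_distributive alg_quot_mul +%R.
Proof.
move=> x y z; rewrite -[x]alg_piK -[y]alg_piK -[z]alg_piK -raddfD.
by rewrite (alg_quot_mulE _ (_ + _)) !(alg_quot_mulE _ (repr _)) mulrDr raddfD.
Qed.

HB.instance Definition _ := GRing.Zmodule_isPzRing.Build alg_quot
  alg_quot_mulA alg_quot_mul1 alg_quot_mulr1 alg_quot_mulDl alg_quot_mulDr.

Fact alg_pi_monoid : monoid_morphism pi.
Proof. by split=> // x y; rewrite -alg_quot_mulE. Qed.

HB.instance Definition _ :=
  GRing.isMonoidMorphism.Build A alg_quot pi alg_pi_monoid.

Fact alg_quot_mapC (a : F) (x : alg_quot) :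
  pi (alg_map a) * x = x * pi (alg_map a).
Proof. by rewrite -[x]alg_piK -!rmorphM alg_mapC. Qed.

HB.instance Definition _ :=
  @isPzAlgebra.Build F alg_quot (pi \o @alg_map F A) alg_quot_mapC.

End AlgebraQuotient.

Section FreeAlgebra.

Variables (F : fieldType) (I : choiceType).

Fact malgC_comm (a : F) (g : {malg F[{fmonom I}]}) :
  malgC a * g = g * malgC a.
Proof.
rewrite !malgM_def fgmulUg fgmulgU; apply/eq_bigr=> k _.
by rewrite mulrC mul1m mulm1.
Qed.

HB.instance Definition _ :=
  @isPzAlgebra.Build F {malg F[{fmonom I}]} (@malgC {fmonom I} F) malgC_comm.

Definition gen (i : I) : {malg F[{fmonom I}]} := << fmu i >>.

End FreeAlgebra.


(* The monoid algebra F[P] of the multiplicative monoid of a ring P; the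
   product of [malg] is restricted to monoids with no invertible element but 1. *)
Section MulMonoidAlgebra.

Variables (F : fieldType) (P : pzRingType).

Definition mmalg : Type := {malg F[P]}.

HB.instance Definition _ := GRing.Zmodule.on mmalg.

Definition mmalgU (c : F) (k : P) : mmalg := << c *g k >>.

Definition mmalg_mul (g h : mmalg) : mmalg :=
  \sum_(k <- msupp g) \sum_(l <- msupp h) mmalgU (g@_k * h@_l) (k * l).

Lemma mmalgU0 k : mmalgU 0 k = 0.
Proof. exact: monalgU0. Qed.

Lemma mmalg_mulw (d e : {fset P}) (g h : mmalg) :
  (msupp g `<=` d)%fset -> (msupp h `<=` e)%fset ->
  mmalg_mul g h = \sum_(k <- d) \sum_(l <- e) mmalgU (g@_k * h@_l) (k * l).
Proof.
move=> gd he; rewrite /mmalg_mul (big_fset_incl _ gd) /=.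
  apply/eq_bigr=> k _; apply/big_fset_incl => // l _ /mcoeff_outdom ->.
  by rewrite mulr0 mmalgU0.
move=> k _ /mcoeff_outdom gk; rewrite big1 // => l _.
by rewrite gk mul0r mmalgU0.
Qed.

Lemma mmalg_mulUU (c d : F) (k l : P) :
  mmalg_mul (mmalgU c k) (mmalgU d l) = mmalgU (c * d) (k * l).
Proof.
by rewrite (mmalg_mulw msuppU_le msuppU_le) !big_seq_fset1 !mcoeffUU.
Qed.

Fact mmalg_mulDl : left_distributive mmalg_mul +%R.
Proof.
move=> g1 g2 h.
rewrite (mmalg_mulw (fsubsetUl (msupp g1) (msupp g2)) (fsubset_refl _)).
rewrite (mmalg_mulw (fsubsetUr (msupp g1) (msupp g2)) (fsubset_refl _)).
rewrite (mmalg_mulw (msuppD_le g1 g2) (fsubset_refl _)) -big_split.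
apply/eq_bigr=> k _; rewrite -big_split; apply/eq_bigr=> l _.
by rewrite mcoeffD mulrDl /mmalgU monalgUD.
Qed.

Fact mmalg_mulDr : right_distributive mmalg_mul +%R.
Proof.
move=> h g1 g2.
rewrite (mmalg_mulw (fsubset_refl _) (fsubsetUl (msupp g1) (msupp g2))).
rewrite (mmalg_mulw (fsubset_refl _) (fsubsetUr (msupp g1) (msupp g2))).
rewrite (mmalg_mulw (fsubset_refl _) (msuppD_le g1 g2)) -big_split.
apply/eq_bigr=> k _; rewrite -big_split; apply/eq_bigr=> l _.
by rewrite mcoeffD mulrDr /mmalgU monalgUD.
Qed.

Fact mmalg_mul0l g : mmalg_mul 0 g = 0.
Proof. by rewrite /mmalg_mul msupp0 big_seq_fset0. Qed.

Fact mmalg_mul0r g : mmalg_mul g 0 = 0.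
Proof. by apply: big1 => k _; rewrite msupp0 big_seq_fset0. Qed.

Lemma mmalgE (g : mmalg) : g = \sum_(k <- msupp g) mmalgU g@_k k.
Proof. exact: monalgE. Qed.

Lemma mmalg_ind (Pr : mmalg -> Prop) :
  Pr 0 -> (forall g h, Pr g -> Pr h -> Pr (g + h)) ->
  (forall c k, Pr (mmalgU c k)) -> forall g, Pr g.
Proof. by move=> P0 PD PU g; rewrite (mmalgE g); apply: big_ind. Qed.

Fact mmalg_mulA : associative mmalg_mul.
Proof.
move=> g1 g2 g3; elim/mmalg_ind: g1 => [|a b ea eb|c k].
- by rewrite !mmalg_mul0l.
- by rewrite !mmalg_mulDl ea eb.
elim/mmalg_ind: g2 => [|a b ea eb|d l].
- by rewrite mmalg_mul0l mmalg_mul0r mmalg_mul0l.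
- by rewrite mmalg_mulDl !mmalg_mulDr mmalg_mulDl ea eb.
elim/mmalg_ind: g3 => [|a b ea eb|e m].
- by rewrite !mmalg_mul0r.
- by rewrite !mmalg_mulDr ea eb.
by rewrite !mmalg_mulUU !mulrA.
Qed.

Fact mmalg_mul1l : left_id (mmalgU 1 1) mmalg_mul.
Proof.
elim/mmalg_ind => [|a b ea eb|c k]; first exact: mmalg_mul0r.
  by rewrite mmalg_mulDr ea eb.
by rewrite mmalg_mulUU !mul1r.
Qed.

Fact mmalg_mul1r : right_id (mmalgU 1 1) mmalg_mul.
Proof.
elim/mmalg_ind => [|a b ea eb|c k]; first exact: mmalg_mul0l.
  by rewrite mmalg_mulDl ea eb.
by rewrite mmalg_mulUU !mulr1.
Qed.

HB.instance Definition _ := GRing.Zmodule_isPzRing.Build mmalg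
  mmalg_mulA mmalg_mul1l mmalg_mul1r mmalg_mulDl mmalg_mulDr.

Lemma mmalgUM (c d : F) (k l : P) :
  mmalgU c k * mmalgU d l = mmalgU (c * d) (k * l).
Proof. exact: mmalg_mulUU. Qed.

Definition mmalgC (c : F) : mmalg := mmalgU c 1.

Fact mmalgC_zmod : zmod_morphism mmalgC.
Proof. by move=> a b; rewrite /mmalgC /mmalgU raddfB. Qed.

Fact mmalgC_monoid : monoid_morphism mmalgC.
Proof. by split=> // a b; rewrite /mmalgC mmalgUM mulr1. Qed.

HB.instance Definition _ :=
  GRing.isZmodMorphism.Build F mmalg mmalgC mmalgC_zmod.
HB.instance Definition _ :=
  GRing.isMonoidMorphism.Build F mmalg mmalgC mmalgC_monoid.

Fact mmalgC_comm (a : F) (g : mmalg) : mmalgC a * g = g * mmalgC a.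
Proof.
elim/mmalg_ind: g => [|g h eg eh|c k]; first by rewrite mulr0 mul0r.
  by rewrite mulrDr mulrDl eg eh.
by rewrite !mmalgUM mulrC mul1r mulr1.
Qed.

HB.instance Definition _ := @isPzAlgebra.Build F mmalg mmalgC mmalgC_comm.

End MulMonoidAlgebra.

Section TensorProduct.

Variables (F : fieldType) (A B : pzAlgType F).

Local Notation e x y := (@mmalgU F (A * B)%type 1 (x, y)).

(* In the algebra F[A x B], with product (x, y)(x', y') = (xx', yy'), the span
   of these elements is already a two-sided ideal; so the quotient has the usual
   tensor product as underlying vector space, and the usual product. *)
Inductive tensor_rel : mmalg F (A * B)%type -> Prop :=
| tensor_addl x x' y : tensor_rel (e (x + x') y - e x y - e x' y)
| tensor_addr x y y' : tensor_rel (e x (y + y') - e x y - e x y')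
| tensor_scalel a x y :
    tensor_rel (e (alg_map a * x) y - alg_map a * e x y)
| tensor_scaler a x y :
    tensor_rel (e x (alg_map a * y) - alg_map a * e x y).

Definition tensor : pzAlgType F := alg_quot tensor_rel.

End TensorProduct.

Fixpoint tensor_pow (F : fieldType) (A : pzAlgType F) (k : nat) : pzAlgType F :=
  if k is k'.+1 then tensor A (tensor_pow A k') else F.

Definition direct_pow (F : fieldType) (m : nat) (A : pzAlgType F) :
  pzAlgType F := {ffun 'I_m -> A}.

Definition M2 (F : fieldType) : pzAlgType F := 'M[F]_2.

Definition adjoin_i (F : fieldType) : pzAlgType F :=
  {poly %/ ('X^2 + 1 : {poly F})}.

(* [{poly %/ p}] is F[X]/(p) only if p is monic and nonconstant. *)
Lemma adjoin_i_modulus (F : fieldType) :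
  mk_monic ('X^2 + 1 : {poly F}) = 'X^2 + 1.
Proof.
have s : size ('X^2 + 1 : {poly F}) = 3.
  by rewrite size_polyDl ?size_polyXn ?size_poly1.
rewrite /mk_monic s /= ifT // monicE lead_coefDl ?lead_coefXn //.
by rewrite size_polyXn size_poly1.
Qed.

Inductive quaternion_rel (F : fieldType) : {malg F[{fmonom bool}]} -> Prop :=
| quaternion_sqr b : quaternion_rel (gen F b ^+ 2 + 1)
| quaternion_anticomm :
    quaternion_rel (gen F true * gen F false + gen F false * gen F true).

Definition quaternion (F : fieldType) : pzAlgType F :=
  alg_quot (@quaternion_rel F).

Definition field_type_I (F : fieldType) : Prop := exists i : F, i ^+ 2 = -1.

Definition field_type_II (F : fieldType) : Prop :=
  ~ (exists i : F, i ^+ 2 = -1) /\ exists x y : F, x ^+ 2 + y ^+ 2 = -1.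

Definition field_type_III (F : fieldType) : Prop :=
  ~ exists x y : F, x ^+ 2 + y ^+ 2 = -1.

Section QuotientSpace.

Variables (K : fieldType) (V : vectType K) (U : {vspace V}).

Definition quot_space :=
  Quotient.quot (GRing.ZmodClosed.clone V (pred_of_vspace U) _).

HB.instance Definition _ := GRing.Zmodule.on quot_space.

Definition quot_pi : V -> quot_space := \pi_quot_space.

Lemma quot_piK : cancel (repr : quot_space -> V) quot_pi.
Proof. exact: reprK. Qed.

Lemma quot_pi_eq x y : (quot_pi x == quot_pi y) = (x - y \in U).
Proof. by rewrite -Quotient.idealrBE. Qed.

Fact quot_pi_zmod : zmod_morphism quot_pi.
Proof. by move=> x y; rewrite /quot_pi !piE. Qed.

HB.instance Definition _ :=
  GRing.isZmodMorphism.Build V quot_space quot_pi quot_pi_zmod.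

Definition quot_scale (a : K) (x : quot_space) := quot_pi (a *: repr x).

Lemma quot_scaleE a x : quot_scale a (quot_pi x) = quot_pi (a *: x).
Proof.
apply/eqP; rewrite quot_pi_eq -scalerBr rpredZ // -quot_pi_eq.
by rewrite quot_piK.
Qed.

Fact quot_scaleA a b x : quot_scale a (quot_scale b x) = quot_scale (a * b) x.
Proof. by rewrite -[x]quot_piK (quot_scaleE b) !quot_scaleE scalerA. Qed.

Fact quot_scale1 : left_id 1 quot_scale.
Proof. by move=> x; rewrite -[x]quot_piK quot_scaleE scale1r. Qed.

Fact quot_scaleDr : right_distributive quot_scale +%R.
Proof.
move=> a x y; rewrite -[x]quot_piK -[y]quot_piK -raddfD.
by rewrite !(quot_scaleE a) scalerDr raddfD.
Qed.

Fact quot_scaleDl x : {morph quot_scale^~ x : a b / a + b}.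
Proof.
by move=> a b; rewrite -[x]quot_piK !quot_scaleE scalerDl raddfD.
Qed.

HB.instance Definition _ := GRing.Zmodule_isLmodule.Build K quot_space
  quot_scaleA quot_scale1 quot_scaleDr quot_scaleDl.

Fact quot_pi_scalable : scalable quot_pi.
Proof. by move=> a x; rewrite -quot_scaleE. Qed.

HB.instance Definition _ :=
  GRing.isScalable.Build K V quot_space *:%R quot_pi quot_pi_scalable.

Fact quot_vect_iso : Vector.axiom (\dim U^C) quot_space.
Proof.
have dUC : (U^C :&: U = 0)%VS by rewrite capvC capv_compl.
have UCfull x : x \in (U^C + U)%VS by rewrite addvC addv_complf memvf.
pose p := daddv_pi U^C U.
have pU x : x - p x \in U.
  by rewrite -{1}(daddv_pi_add dUC (UCfull x)) addrAC subrr add0r memv_pi.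
have pUC x : p x \in (U^C)%VS by exact: memv_pi.
have p0 x : x \in U -> p x = 0.
  move=> xU; apply/eqP; rewrite -memv0 -dUC memv_cap pUC /=.
  by rewrite -[p x](subKr x) rpredB.
have prepr x : p (repr (quot_pi x)) = p x.
  apply/eqP; rewrite -subr_eq0 -linearB; apply/eqP/p0.
  by rewrite -quot_pi_eq quot_piK.
have [g glin gbij] := subvs_vect_iso U^C%VS.
exists (fun x : quot_space => g (vsproj U^C (p (repr x)))).
  move=> a x y; rewrite -glin; congr (g _).
  by rewrite -[x]quot_piK -[y]quot_piK -linearP !prepr !linearP.
have [h gK hK] := gbij.
exists (fun r => quot_pi (vsval (h r))) => [x | r].
  rewrite gK vsprojK // -[RHS]quot_piK; apply/eqP; rewrite eq_sym.
  by rewrite quot_pi_eq.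
rewrite prepr.
have -> : p (vsval (h r)) = vsval (h r).
  by rewrite /p daddv_pi_id // subvsP.
by rewrite vsvalK hK.
Qed.

HB.instance Definition _ := Lmodule_hasFinDim.Build K quot_space quot_vect_iso.

Lemma dim_quot_space : \dim {: quot_space} = (\dim {:V} - \dim U)%N.
Proof. by rewrite dimvf /dim /= dimv_compl. Qed.

End QuotientSpace.

Definition polar (V : zmodType) (Q : V -> 'F_2) (v w : V) : 'F_2 :=
  Q (v + w) + Q v + Q w.

(* [polar] is symmetric, so linearity in one variable gives bilinearity. *)
Record quad_form (V : vectType 'F_2) := QuadForm {
  quad :> V -> 'F_2;
  quadZ : forall a v, quad (a *: v) = a ^+ 2 * quad v;
  polar_scalar : forall v, scalar (polar quad v)
}.

Section Radical.

Variables (V : vectType 'F_2) (Q : quad_form V).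

Lemma polarC v w : polar Q v w = polar Q w v.
Proof. by rewrite /polar [v + w]addrC addrAC. Qed.

Lemma polarP u a v w : polar Q u (a *: v + w) = a * polar Q u v + polar Q u w.
Proof. exact: polar_scalar. Qed.

Lemma polar0r u : polar Q u 0 = 0.
Proof. by rewrite -[0 in LHS](addNr u) -scaleN1r polarP mulN1r addNr. Qed.

(* The span of the vectors satisfying P, through [finvect_type V], which is V
   seen as a finite type. *)
Definition span_pred (P : pred V) : {vspace V} :=
  <<enum (P : pred (finvect_type V)) : seq V>>%VS.

Lemma mem_span_pred (P : pred V) :
  P 0 -> (forall a v w, P v -> P w -> P (a *: v + w)) ->
  forall v : V, (v \in span_pred P) = P v.
Proof.
move=> P0 PL v.
have sP (u : V) : (u \in (enum (P : pred (finvect_type V)) : seq V)) = P u.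
  exact: (mem_enum (P : pred (finvect_type V))).
apply/idP/idP => [|Pv]; last by apply: memv_span; rewrite sP.
move/(@coord_span _ _ _ (in_tuple _)) ->.
apply: (big_ind (fun v => is_true (P v))) => // [x y Px Py | i _].
  by rewrite -[x]scale1r PL.
by rewrite -[_ *: _]addr0 PL // -sP mem_nth.
Qed.

Definition rad_polar : {vspace V} :=
  span_pred (fun v => [forall w : finvect_type V, polar Q v w == 0]).

Definition rad_quad : {vspace V} :=
  span_pred (fun v => (v \in rad_polar) && (Q v == 0)).

Lemma rad_polarP v : reflect (forall w, polar Q v w = 0) (v \in rad_polar).
Proof.
rewrite mem_span_pred => [||a x y /forallP hx /forallP hy].
- by apply: (iffP forallP) => h w; apply/eqP; move: (h w).
- by apply/forallP=> w; rewrite polarC polar0r.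
apply/forallP=> w; rewrite polarC polarP !(polarC w).
by rewrite (eqP (hx w)) (eqP (hy w)) mulr0 addr0.
Qed.

Lemma quad0 : Q 0 = 0.
Proof. by rewrite -(scale0r 0) quadZ expr0n mul0r. Qed.

Lemma quadD v w : Q (v + w) = Q v + Q w + polar Q v w.
Proof.
have dbl (x : 'F_2) : x + x = 0 by exact: (addrr_pchar2 (@pchar_Fp 2 isT)).
by rewrite /polar -[Q (v + w) + _ + _]addrA [RHS]addrC -addrA dbl addr0.
Qed.

Lemma rad_quadP v :
  reflect ((forall w, polar Q v w = 0) /\ Q v = 0) (v \in rad_quad).
Proof.
rewrite mem_span_pred => [||a x y /andP[hx /eqP qx] /andP[hy /eqP qy]].
- by apply: (iffP andP) => -[/rad_polarP h /eqP].
- by rewrite mem0v quad0 eqxx.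
rewrite memvD ?memvZ //= quadD quadZ qx qy polarC (rad_polarP _ hy).
by rewrite !(mulr0, addr0).
Qed.

(* The form induced by Q on V / Rad(Q); see [quad_quotE]. *)
Definition quad_quot_fun (x : quot_space rad_quad) : 'F_2 := Q (repr x).

Lemma quad_quotE v : quad_quot_fun (quot_pi rad_quad v) = Q v.
Proof.
rewrite /quad_quot_fun; set w := repr _.
have : w - v \in rad_quad by rewrite -quot_pi_eq quot_piK.
case/rad_quadP=> h q; rewrite -[w](subrK v) quadD q h.
by rewrite add0r addr0.
Qed.

Lemma polar_quot v w :
  polar quad_quot_fun (quot_pi rad_quad v) (quot_pi rad_quad w) = polar Q v w.
Proof. by rewrite /polar -raddfD !quad_quotE. Qed.

Fact quad_quotZ a x : quad_quot_fun (a *: x) = a ^+ 2 * quad_quot_fun x.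
Proof. by rewrite -[x]quot_piK -linearZ !quad_quotE quadZ. Qed.

Fact polar_quot_scalar x : scalar (polar quad_quot_fun x).
Proof.
move=> a y z; rewrite -[x]quot_piK -[y]quot_piK -[z]quot_piK -linearP.
by rewrite !polar_quot polarP.
Qed.

Definition quad_quot : quad_form (quot_space rad_quad) :=
  QuadForm quad_quotZ polar_quot_scalar.

End Radical.

Section Types.

Variables (V : vectType 'F_2) (Q : quad_form V).

Definition zero_line (U : {vspace V}) : Prop :=
  exists2 e : V, basis_of U [:: e] & forall x : 'F_2, Q (x *: e) = x ^+ 2.

Definition plus_plane (U : {vspace V}) : Prop :=
  exists e1 e2 : V, basis_of U [:: e1; e2] /\
    forall x1 x2 : 'F_2, Q (x1 *: e1 + x2 *: e2) = x1 * x2.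

Definition minus_plane (U : {vspace V}) : Prop :=
  exists e1 e2 : V, basis_of U [:: e1; e2] /\
    forall x1 x2 : 'F_2,
      Q (x1 *: e1 + x2 *: e2) = x1 ^+ 2 + x1 * x2 + x2 ^+ 2.

(* V is the orthogonal direct sum of the U i and of Rad(Q); the latter is
   orthogonal to everything. *)
Definition orthogonal_decomposition k (U : 'I_k -> {vspace V}) : Prop :=
  [/\ (\sum_i U i + rad_quad Q)%VS = fullv,
      directv (\sum_i U i + rad_quad Q) &
      forall i j, i != j ->
        forall v w, v \in U i -> w \in U j -> polar Q v w = 0].

Definition plus_type : Prop :=
  exists k (U : 'I_k -> {vspace V}),
    orthogonal_decomposition U /\ forall i, plus_plane (U i).

Definition minus_type : Prop :=
  exists k (U : 'I_k -> {vspace V}), orthogonal_decomposition U /\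
    exists i0, minus_plane (U i0) /\ forall i, i != i0 -> plus_plane (U i).

Definition zero_type : Prop :=
  exists k (U : 'I_k -> {vspace V}), orthogonal_decomposition U /\
    exists i0, zero_line (U i0) /\ forall i, i != i0 -> plus_plane (U i).

End Types.

Section QuasiClifford.

Variables (F : fieldType) (V : vectType 'F_2) (Q : quad_form V).
Variables (m : nat) (X : m.-tuple V).

(* The generator [gen F i] stands for the basis vector [tnth X i]; an element
   of 'F_2, used as an exponent, is coerced to 0 or 1 in nat. *)
Inductive quasi_clifford_rel : {malg F[{fmonom 'I_m}]} -> Prop :=
| quasi_clifford_sqr i :
    quasi_clifford_rel (gen F i ^+ 2 - (-1) ^+ Q (tnth X i))
| quasi_clifford_comm i j of i != j :
    quasi_clifford_rel (gen F i * gen F j -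
      (-1) ^+ polar Q (tnth X i) (tnth X j) * (gen F j * gen F i)).

Definition quasi_clifford : pzAlgType F := alg_quot quasi_clifford_rel.

End QuasiClifford.

(* Main.v *)
Require Import Defs.
From HB Require Import structures.
From mathcomp Require Import all_boot all_order all_algebra finfield.
From mathcomp Require Import boolp.
From mathcomp Require Import finmap monalg ring.

Set Implicit Arguments.
Unset Strict Implicit.
Unset Printing Implicit Defensive.

Import GRing.Theory.
Local Open Scope ring_scope.

(**
  Let W be an elementary abelian 2-group with a quadratic form q, and call a
  family (b v) indexed by v in W of elements of an F-algebra A a model of q when
  b v * b w = b (v + w) or - b (v + w), when b v squares to (-1)^(q v), when the
  b v generate A, and when A carries a linear form t with t 1 = 1 that kills
  b v for v != 0. The squares determine the commutation signs: b v and b w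
  commute up to (-1)^(f v w) ([model_comm]).

  If A has a model of (V, Q), then C(V, Q) is isomorphic to A
  ([quasi_clifford_isom]), whatever the basis X that presents C(V, Q). Sending
  the generators to the b (X i) respects the defining relations; the resulting
  morphism is onto because every b v is, up to sign, a product of the b (X i).
  The ordered monomials in the generators span C(V, Q), and the form t
  separates their images, the elements b v up to sign; so the morphism is
  one-to-one. It is therefore enough to exhibit a model of (V, Q) in each of
  the algebras of the statement, and models can be assembled from small ones:

  - models of q1 and q2 in A and B give a model of the orthogonal sum of q1 and
    q2 in the tensor product of A and B ([has_model_tensor]);
  - a model of q in A gives a model of the sum of q and the zero form on F_2^m
    in the product of 2^m copies of A: the new vectors act by the characters
    of F_2^m, and the characters span the functions on F_2^m because 2 is
    invertible ([has_model_direct_pow]);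
  - M(2,F) has a model of the plus plane ([M2_plus]), and also one of the minus
    plane if x^2 + y^2 = -1 is solvable ([M2_minus]); the quaternion algebra
    has a model of the minus plane ([quaternion_model]) and F[i] one of the
    line ([adjoin_i_model]).

  A decomposition of the induced form on V / Rad(Q) into planes and possibly a
  line gives coordinates in which that form is such an orthogonal sum
  ([planes_isometric]), and (V, Q) is its sum with the zero form on Rad(Q)
  ([rad_split]). If F contains i with i^2 = -1, the line acts by the scalar i
  together with one more character, which doubles the number of factors and
  removes F[i] ([zero_model_split]).
*)

(** * Subalgebras, linear forms and equality up to sign *)

Section Generalities.

Variable F : fieldType.
Implicit Types A B : pzAlgType F.

Record alg_closed A (P : A -> Prop) : Prop := AlgClosed {
  alg_closedC : forall a : F, P (alg_map a);
  alg_closedD : forall x y, P x -> P y -> P (x + y);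
  alg_closedM : forall x y, P x -> P y -> P (x * y)
}.

Lemma alg_closed1 A (P : A -> Prop) : alg_closed P -> P 1.
Proof. by move/alg_closedC/(_ 1); rewrite rmorph1. Qed.

Lemma alg_closedZ A (P : A -> Prop) a x :
  alg_closed P -> P x -> P (alg_map a * x).
Proof. by move=> cP Px; apply: alg_closedM => //; exact: alg_closedC. Qed.

Lemma alg_closedN A (P : A -> Prop) x : alg_closed P -> P x -> P (- x).
Proof.
by move=> cP Px; rewrite -mulN1r -(rmorph1 alg_map) -rmorphN; exact: alg_closedZ.
Qed.

Lemma alg_closed_sum A (P : A -> Prop) (I : Type) (r : seq I) (g : I -> A) :
  alg_closed P -> (forall i, P (g i)) -> P (\sum_(i <- r) g i).
Proof.
move=> cP Pg; apply: (big_ind P) => //; last exact: alg_closedD.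
by rewrite -(rmorph0 alg_map); exact: alg_closedC.
Qed.

Record linear_form A (t : A -> F) : Prop := LinearForm {
  linear_formD : forall x y, t (x + y) = t x + t y;
  linear_formZ : forall a x, t (alg_map a * x) = a * t x
}.

Lemma linear_form0 A (t : A -> F) : linear_form t -> t 0 = 0.
Proof.
by move=> lt; rewrite -[X in t X](mul0r 1) -(rmorph0 alg_map) linear_formZ // mul0r.
Qed.

Lemma linear_formN A (t : A -> F) x : linear_form t -> t (- x) = - t x.
Proof.
move=> lt; apply/eqP; rewrite -subr_eq0 opprK addrC -linear_formD // subrr.
by rewrite linear_form0.
Qed.

Lemma linear_form_sum A (t : A -> F) (I : Type) (r : seq I) (g : I -> A) :
  linear_form t -> t (\sum_(i <- r) g i) = \sum_(i <- r) t (g i).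
Proof.
by move=> lt; apply: big_morph => [x y|]; rewrite ?linear_formD ?linear_form0.
Qed.

Section LinearSpan.

Variables (A : pzAlgType F) (I : finType) (g : I -> A).

Definition lin_span (x : A) : Prop :=
  exists c : I -> F, x = \sum_i alg_map (c i) * g i.

Lemma lin_spanD x y : lin_span x -> lin_span y -> lin_span (x + y).
Proof.
move=> [c ->] [d ->]; exists (fun i => c i + d i).
by rewrite -big_split; apply: eq_bigr => i _; rewrite rmorphD mulrDl.
Qed.

Lemma lin_spanZ k x : lin_span x -> lin_span (alg_map k * x).
Proof.
move=> [c ->]; exists (fun i => k * c i).
by rewrite mulr_sumr; apply: eq_bigr => i _; rewrite rmorphM mulrA.
Qed.

Lemma lin_span0 : lin_span 0.
Proof. by exists (fun=> 0); rewrite big1 // => i _; rewrite rmorph0 mul0r. Qed.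

Lemma lin_spanN x : lin_span x -> lin_span (- x).
Proof. by rewrite -mulN1r -(rmorph1 alg_map) -rmorphN; exact: lin_spanZ. Qed.

Lemma lin_span_gen i : lin_span (g i).
Proof.
exists (fun j => (j == i)%:R); rewrite (bigD1 i) //= eqxx rmorph1 mul1r.
by rewrite big1 ?addr0 // => j /negPf ->; rewrite rmorph0 mul0r.
Qed.

End LinearSpan.

Definition eqpm A (x y : A) : Prop := x = y \/ x = - y.

Lemma eqpm_refl A (x : A) : eqpm x x. Proof. by left. Qed.

Lemma eqpm_sym A (x y : A) : eqpm x y -> eqpm y x.
Proof. by case=> ->; rewrite /eqpm ?opprK; auto. Qed.

Lemma eqpm_trans A (y x z : A) : eqpm x y -> eqpm y z -> eqpm x z.
Proof. by case=> -> [] ->; rewrite /eqpm ?opprK; auto. Qed.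

Lemma eqpmM A (x x' y y' : A) :
  eqpm x x' -> eqpm y y' -> eqpm (x * y) (x' * y').
Proof. by case=> -> [] ->; rewrite /eqpm ?mulNr ?mulrN ?opprK; auto. Qed.

Lemma alg_closed_eqpm A (P : A -> Prop) x y :
  alg_closed P -> eqpm x y -> P y -> P x.
Proof. by move=> cP [] -> // Py; apply: alg_closedN. Qed.

Lemma eqpm_sign A (k : nat) (x : A) : eqpm ((-1) ^+ k * x) x.
Proof.
by rewrite -signr_odd; case: odd; rewrite ?mulN1r ?mul1r; [right|left].
Qed.

Lemma F2P (x : 'F_2) : x = 0 \/ x = 1.
Proof. by case: x => [[|[|//]] p]; [left|right]; apply/val_inj. Qed.

Lemma signF2D A (x y : 'F_2) :
  (-1) ^+ (x + y)%R = (-1) ^+ x * (-1) ^+ y :> A.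
Proof.
case: (F2P x) => ->; case: (F2P y) => ->;
 by rewrite ?addr0 ?add0r ?expr0 ?mul1r ?mulr1 // mulrNN mulr1.
Qed.

(** * Quotients and free algebras *)

(** The universal property of a quotient by generators of an ideal. *)
Lemma alg_quot_lift A B (S : A -> Prop) (h : {rmorphism A -> B}) :
  (forall a, h (alg_map a) = alg_map a) -> (forall x, S x -> h x = 0) ->
  exists f : {rmorphism alg_quot S -> B},
    (forall x, f (alg_pi S x) = h x) /\ forall a, f (alg_map a) = alg_map a.
Proof.
move=> hC hS.
have hI x : ideal_gen S x -> h x = 0.
  elim=> [y /hS//||y z _ hy _ hz|a y _ hy|a y _ hy]; first exact: rmorph0.
  - by rewrite rmorphB hy hz subr0.
  - by rewrite rmorphM hy mulr0.
  - by rewrite rmorphM hy mul0r.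
pose f (x : alg_quot S) := h (repr x).
have fE x : f (alg_pi S x) = h x.
  apply/eqP; rewrite -subr_eq0 -rmorphB; apply/eqP/hI/alg_pi_eqP.
  by rewrite alg_piK.
have fB : zmod_morphism f.
  by move=> x y; rewrite -[x]alg_piK -[y]alg_piK -rmorphB !fE rmorphB.
have fM : monoid_morphism f.
  split; first by rewrite -(rmorph1 (alg_pi S)) fE rmorph1.
  by move=> x y; rewrite -[x]alg_piK -[y]alg_piK -rmorphM !fE rmorphM.
pose fm : {rmorphism alg_quot S -> B} :=
  HB.pack f (GRing.isZmodMorphism.Build _ _ f fB)
            (GRing.isMonoidMorphism.Build _ _ f fM).
by exists fm; split=> [|a]; [exact: fE | rewrite -hC -fE].
Qed.

Lemma alg_quot_closed A (S : A -> Prop) (P : alg_quot S -> Prop) :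
  alg_closed P -> alg_closed (fun x => P (alg_pi S x)).
Proof.
move=> cP; split=> [a|x y Px Py|x y Px Py].
- exact: (alg_closedC cP a).
- by rewrite rmorphD; apply: alg_closedD.
- by rewrite rmorphM; apply: alg_closedM.
Qed.

Section LinearExtension.

Variables (K : choiceType) (B : pzAlgType F) (h : K -> B).

(** The linear extension of h to the free module on K. It serves both for the
    morphisms out of a free algebra and for the linear forms on a tensor
    product. *)
Definition lin_ext (g : {malg F[K]}) : B :=
  \sum_(k <- msupp g) alg_map g@_k * h k.

Lemma lin_extw (d : {fset K}) g : (msupp g `<=` d)%fset ->
  lin_ext g = \sum_(k <- d) alg_map g@_k * h k.
Proof.
move=> le; rewrite [LHS](big_fset_incl _ le) => //= x xd /mcoeff_outdom ->.
by rewrite rmorph0 mul0r.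
Qed.

Lemma lin_extU c k : lin_ext << c *g k >> = alg_map c * h k.
Proof. by rewrite (lin_extw msuppU_le) big_seq_fset1 mcoeffUU. Qed.

Lemma lin_ext_zmod : zmod_morphism lin_ext.
Proof.
move=> g1 g2; pose d := (msupp g1 `|` msupp g2 `|` msupp (g1 - g2))%fset.
have d1 : (msupp g1 `<=` d)%fset by rewrite /d -fsetUA fsubsetUl.
have d2 : (msupp g2 `<=` d)%fset by rewrite /d fsetUAC fsubsetUr.
rewrite (lin_extw d1) (lin_extw d2) (@lin_extw d) ?fsubsetUr //.
by rewrite -sumrB; apply/eq_bigr=> k _; rewrite !raddfB /= mulrBl.
Qed.

HB.instance Definition _ :=
  GRing.isZmodMorphism.Build {malg F[K]} B lin_ext lin_ext_zmod.

End LinearExtension.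

Section FreeAlgebraMorphism.

Variables (I : choiceType).

Lemma malg_free_ind (P : {malg F[{fmonom I}]} -> Prop) :
  alg_closed P -> (forall i, P (gen F i)) -> forall x, P x.
Proof.
move=> cP Pg x; rewrite (monalgE x); apply: alg_closed_sum => // k.
have -> : << x@_k *g k >> = alg_map x@_k * << k >> :> {malg F[{fmonom I}]}.
  by rewrite /alg_map /= /malgC malgM_def fgmulUU mulr1 mul1m.
apply: alg_closedZ => //; case: k => s; elim: s => [|i s IHs].
  have -> : << FMonom [::] >> = 1 :> {malg F[{fmonom I}]}.
    by congr << _ >>; rewrite -fmoneE.
  exact: alg_closed1.
have -> : << FMonom (i :: s) >> = gen F i * << FMonom s >> :> {malg F[{fmonom I}]}.
  rewrite /gen malgM_def fgmulUU mulr1; congr << _ >>.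
  by apply: val_inj; rewrite /= fmM fmU.
exact: alg_closedM.
Qed.

Lemma free_morph B (h : I -> B) :
  exists f : {rmorphism {malg F[{fmonom I}]} -> B},
    (forall i, f (gen F i) = h i) /\ forall a, f (alg_map a) = alg_map a.
Proof.
pose hm (k : {fmonom I}) := \prod_(i <- (k : seq I)) h i.
have hm1 : hm mone = 1 by rewrite /hm fm1 big_nil.
have hmM k l : hm (mmul k l) = hm k * hm l by rewrite /hm fmM big_cat.
have fM : monoid_morphism (lin_ext hm).
  split; first by rewrite lin_extU rmorph1 mul1r.
  move=> x y; rewrite malgME raddf_sum [in RHS]/lin_ext mulr_suml; apply: eq_bigr => i _.
  rewrite raddf_sum /= mulr_sumr; apply: eq_bigr => j _.
  rewrite lin_extU rmorphM hmM -!mulrA; congr (_ * _).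
  by rewrite !mulrA alg_mapC.
pose f : {rmorphism {malg F[{fmonom I}]} -> B} :=
  HB.pack (lin_ext hm) (GRing.isMonoidMorphism.Build _ _ _ fM).
exists f; split=> [i|a]; rewrite /= lin_extU.
  by rewrite rmorph1 mul1r /hm fmU big_seq1.
by rewrite hm1 mulr1.
Qed.

End FreeAlgebraMorphism.

End Generalities.

(** * Models of quadratic forms in algebras *)

Section Models.

Variable F : fieldType.
Implicit Types A B : pzAlgType F.

(** The elements b v form a basis of A. Their linear independence is recorded
    through the form t because such forms multiply in tensor products, average
    over direct powers and can be pulled back along morphisms. *)
Record clifford_model (W : zmodType) (q : W -> 'F_2) A
    (b : W -> A) (t : A -> F) : Prop := CliffordModel {
  model_mul : forall v w, eqpm (b v * b w) (b (v + w));
  model_sqr : forall v, b v * b v = (-1) ^+ q v;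
  model_gen : forall P, alg_closed P -> (forall v, P (b v)) -> forall x, P x;
  model_lin : linear_form t;
  model_tr1 : t 1 = 1;
  model_tr0 : forall v, v != 0 -> t (b v) = 0
}.

Definition has_model (W : zmodType) (q : W -> 'F_2) A : Prop :=
  exists b t, @clifford_model W q A b t.

Section ModelTheory.

Variables (W : zmodType) (q : W -> 'F_2) (A : pzAlgType F).
Variables (b : W -> A) (t : A -> F).
Hypothesis mb : clifford_model q b t.

Lemma sign_mulK (e : 'F_2) (x : A) : (-1) ^+ e * ((-1) ^+ e * x) = x.
Proof. by rewrite mulrA -expr2 sqrr_sign mul1r. Qed.

Lemma model_sqr1 v : eqpm (b v * b v) 1.
Proof. by rewrite (model_sqr mb) -[_ ^+ _]mulr1; exact: eqpm_sign. Qed.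

(** Up to sign b 0 is its own square, and squares are 1 up to sign. *)
Lemma model0 : eqpm (b 0) 1.
Proof.
apply: eqpm_trans (model_sqr1 0); apply: eqpm_sym.
by rewrite -{3}(addr0 0); exact: (model_mul mb).
Qed.

Lemma model_tr_eqpm1 x : eqpm x 1 -> t x != 0.
Proof.
have lt := model_lin mb.
by case=> ->; rewrite ?linear_formN // (model_tr1 mb) ?oppr_eq0 oner_neq0.
Qed.

(** Only the squares have to be prescribed: expanding (b v * b w)^2 in two
    ways shows that they determine the commutation signs, just as a quadratic
    form determines its polar form. *)
Lemma model_comm v w : b v * b w = (-1) ^+ polar q v w * (b w * b v).
Proof.
set x := b v * b w; set y := b w * b v.
have sx : x * x = (-1) ^+ q (v + w).
  rewrite -(model_sqr mb); rewrite /x.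
  by case: (model_mul mb v w) => ->; rewrite ?mulrNN.
have sgnC (e : 'F_2) (z : A) : z * (-1) ^+ e = (-1) ^+ e * z.
  by case: (F2P e) => ->; rewrite ?mulr1 ?mul1r // mulrN mulr1 mulN1r.
have : b v * (x * x) * b w = (-1) ^+ q (v + w) * x by rewrite sx sgnC -mulrA.
have -> : b v * (x * x) * b w = (b v * b v) * y * (b w * b w).
  by rewrite /x /y !mulrA.
rewrite !(model_sqr mb) sgnC => E.
rewrite /polar !signF2D -!mulrA [X in _ * X]mulrA -signF2D [q v + q w]addrC signF2D.
by rewrite -mulrA E sign_mulK.
Qed.

End ModelTheory.

Section Uniqueness.

Variables (V : vectType 'F_2) (Q : quad_form V) (m : nat) (X : m.-tuple V).
Hypothesis basisX : basis_of {:V} X.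

Local Notation C := (quasi_clifford F Q X).
Local Notation vec := {ffun 'I_m -> 'F_2}.

Definition cgen (i : 'I_m) : C := alg_pi _ (gen F i).

Let pi := alg_pi (@quasi_clifford_rel F V Q m X).

Lemma cgen_rel x y : quasi_clifford_rel Q X (x - y) -> pi x = pi y.
Proof. by move=> Sxy; apply/eqP/alg_pi_eqP; exact: ideal_gen_rel. Qed.

Let piM x y : pi (x * y) = pi x * pi y.
Proof. exact: rmorphM. Qed.

Let pi_sign k : pi ((-1) ^+ k) = (-1) ^+ k.
Proof. by rewrite /pi rmorphXn rmorphN rmorph1. Qed.

Lemma cgen_sqr i : cgen i * cgen i = (-1) ^+ Q (tnth X i).
Proof.
by rewrite -pi_sign -(cgen_rel (quasi_clifford_sqr F Q X i)) expr2 piM.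
Qed.

Lemma cgen_comm i j : eqpm (cgen i * cgen j) (cgen j * cgen i).
Proof.
have [->|ij] := eqVneq i j; first exact: eqpm_refl.
have := cgen_rel (quasi_clifford_comm F Q X ij).
by rewrite 3!piM pi_sign => ->; exact: eqpm_sign.
Qed.

Lemma cgen_ind (P : C -> Prop) :
  alg_closed P -> (forall i, P (cgen i)) -> forall x, P x.
Proof.
move=> cP Pg x; rewrite -[x]alg_piK.
by apply: (malg_free_ind (alg_quot_closed cP)).
Qed.

(** An exponent in F_2 is read as the natural number 0 or 1, so this is the
    product over s, in the order of s, of the generators i with a i = 1. *)
Definition cmon (s : seq 'I_m) (a : vec) : C := \prod_(i <- s) cgen i ^+ (a i).

Lemma cmon_ext s (a c : vec) : {in s, a =1 c} -> cmon s a = cmon s c.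
Proof. by move=> ac; apply: eq_big_seq => i /ac ->. Qed.

Definition unit_vec i : vec := [ffun j => (j == i)%:R].

(** The generator i moves through the monomial up to sign until it meets its own
    power, which it switches between 0 and 1. *)
Lemma cgen_cmon (s : seq 'I_m) i (a : vec) : uniq s -> i \in s ->
  eqpm (cgen i * cmon s a) (cmon s (a + unit_vec i)).
Proof.
elim: s => // j s IHs /= /andP[js us].
rewrite inE /cmon !big_cons -!/(cmon _ _) !ffunE.
have [-> _ | nij] := eqVneq i j; last rewrite orFb addr0 => iIs.
  have -> : cmon s (a + unit_vec j) = cmon s a.
    apply: cmon_ext => k ks; rewrite !ffunE.
    by case: eqP => [kj|]; rewrite ?addr0 // -kj ks in js *.
  rewrite mulrA -exprS.
  case: (F2P (a j)) => -> /=; first exact: eqpm_refl.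
  apply: eqpmM (eqpm_refl _); rewrite expr2 cgen_sqr.
  by rewrite -[_ ^+ _]mulr1; exact: eqpm_sign.
apply: (@eqpm_trans _ _ (cgen j ^+ a j * cgen i * cmon s a)).
  rewrite mulrA; apply: eqpmM (eqpm_refl _).
  case: (F2P (a j)) => -> /=; first by rewrite mulr1 mul1r; exact: eqpm_refl.
  exact: cgen_comm.
by rewrite -mulrA; apply: eqpmM (eqpm_refl _) (IHs us iIs).
Qed.

Definition cbas := cmon (enum 'I_m).

(** By the previous lemma the span of the square-free ordered monomials is a left
    ideal, and it contains the empty monomial 1. *)
Lemma cbas_span (x : C) : lin_span cbas x.
Proof.
pose T := lin_span cbas.
have ideal : forall x y, T y -> T (x * y).
  move=> {}x; apply: (@cgen_ind (fun x => forall y, T y -> T (x * y))).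
    split=> [k y|y z hy hz w Tw|y z hy hz w Tw]; first exact: lin_spanZ.
      by rewrite mulrDl; apply: lin_spanD; [exact: hy | exact: hz].
    by rewrite -mulrA; exact/hy/hz.
  move=> i y [c ->]; rewrite mulr_sumr; apply: (big_ind T) => [||a _].
  - exact: lin_span0.
  - exact: lin_spanD.
  rewrite mulrA -alg_mapC -mulrA; apply: lin_spanZ.
  have := cgen_cmon a (enum_uniq 'I_m) (mem_enum 'I_m i).
  by case=> ->; [|apply: lin_spanN]; exact: lin_span_gen.
have -> : x = x * cbas 0.
  rewrite /cbas /cmon big1 ?mulr1 // => i _.
  by rewrite ffunE expr0.
exact/ideal/lin_span_gen.
Qed.

Let coord_vec (a : vec) : V := \sum_(i <- enum 'I_m) a i *: tnth X i.

Let coord_vec_inj a c : coord_vec a = coord_vec c -> a = c.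
Proof.
have fX : free X by exact: basis_free basisX.
move/eqP; rewrite -subr_eq0 /coord_vec -sumrB big_enum /=.
under eq_bigr => i _ do rewrite -scalerBl (tnth_nth 0).
move/freeP: fX => /(_ (fun i => a i - c i)) fX /eqP/fX h; apply/ffunP => i.
by apply/eqP; rewrite -subr_eq0 h.
Qed.

Let coord_vec_surj v : exists a, v = coord_vec a.
Proof.
exists [ffun i => coord X i v]; rewrite {1}(coord_basis basisX (memvf v)).
rewrite /coord_vec big_enum /=; apply: eq_bigr => i _.
by rewrite ffunE (tnth_nth 0).
Qed.

Let oppv2 (v : V) : - v = v.
Proof.
by rewrite -scaleN1r (_ : -1 = 1 :> 'F_2) ?scale1r //; apply/val_inj.
Qed.

(** The relations give a morphism f from C to A. It is onto since the b v generate
    A, and the form t detects each coefficient of an element of the kernel. *)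
Lemma quasi_clifford_isom A : has_model Q A -> alg_isom C A.
Proof.
case=> b [t mb].
have lt := model_lin mb.
have [h [hg hC]] := free_morph (fun i => b (tnth X i)).
have hsign k : h ((-1) ^+ k) = (-1) ^+ k by rewrite rmorphXn rmorphN rmorph1.
have [|f [fE fC]] := @alg_quot_lift _ _ _ (@quasi_clifford_rel F V Q m X) h hC.
  move=> _ [i|i j _]; rewrite rmorphB.
    by rewrite hsign expr2 rmorphM hg (model_sqr mb) subrr.
  by rewrite !(rmorphM h) hsign !hg -(model_comm mb) subrr.
have fcbas a : eqpm (f (cbas a)) (b (coord_vec a)).
  rewrite /cbas /cmon /coord_vec; elim: (enum 'I_m) => [|i s IHs].
    by rewrite !big_nil rmorph1; apply/eqpm_sym/(model0 mb).
  rewrite !big_cons rmorphM; apply: eqpm_trans (model_mul mb _ _).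
  apply: eqpmM IHs; rewrite rmorphXn /= fE hg.
  case: (F2P (a i)) => ->; last by rewrite scale1r; exact: eqpm_refl.
  by rewrite scale0r; apply/eqpm_sym/(model0 mb).
have f_tr c a : c != a -> t (b (coord_vec c) * f (cbas a)) = 0.
  move=> ca; have : eqpm (b (coord_vec c) * f (cbas a))
                        (b (coord_vec c + coord_vec a)).
    by apply: eqpm_trans (model_mul mb _ _); apply: eqpmM (fcbas a); left.
  have nz : coord_vec c + coord_vec a != 0.
    by rewrite addr_eq0 oppv2; apply: contraNneq ca => /coord_vec_inj ->.
  by case=> ->; rewrite ?linear_formN // (model_tr0 mb) ?oppr0.
have f_inj x : f x = 0 -> x = 0.
  have [c ->] := cbas_span x => fx0.
  apply: big1 => a _; suff -> : c a = 0 by rewrite rmorph0 mul0r.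
  (* Up to sign, c a is the image under t of b (coord_vec a) * f x. *)
  have := linear_form0 lt; rewrite -[X in t X](mulr0 (b (coord_vec a))) -fx0.
  rewrite rmorph_sum mulr_sumr linear_form_sum // (bigD1 a) //= big1 => [|d da].
    rewrite addr0 rmorphM fC mulrA -alg_mapC -mulrA linear_formZ // => /eqP.
    rewrite mulf_eq0 => /orP[/eqP //|].
    have /(model_tr_eqpm1 mb)/negPf -> // : eqpm (b (coord_vec a) * f (cbas a)) 1.
    apply: eqpm_trans (model_sqr1 mb (coord_vec a)).
    by apply: eqpmM (fcbas a); left.
  rewrite rmorphM fC mulrA -alg_mapC -mulrA linear_formZ // f_tr ?mulr0 //.
  by rewrite eq_sym.
have f_surj : forall y, exists x, f x == y.
  apply: (model_gen mb); first split=> [a|y z|y z].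
  - by exists (alg_map a); rewrite fC.
  - by move=> [u /eqP <-] [v /eqP <-]; exists (u + v); rewrite rmorphD.
  - by move=> [u /eqP <-] [v /eqP <-]; exists (u * v); rewrite rmorphM.
  move=> v; have [a ->] := coord_vec_surj v.
  by have [fa|fa] := fcbas a; [exists (cbas a) | exists (- cbas a)];
    rewrite ?rmorphN fa ?opprK.
exists f; split=> //; exists (fun y => xchoose (f_surj y)) => [x|y].
  apply/eqP; rewrite -subr_eq0; apply/eqP/f_inj.
  by rewrite rmorphB (eqP (xchooseP (f_surj (f x)))) subrr.
exact/eqP/(xchooseP (f_surj y)).
Qed.

End Uniqueness.
End Models.

(** * Transport and tensor products of models *)

Section Constructions.

Variable F : fieldType.
Implicit Types A B : pzAlgType F.

Lemma has_model_transport (W W' : zmodType) (q : W -> 'F_2) (q' : W' -> 'F_2) A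
    (phi : W' -> W) :
  {morph phi : x y / x + y} -> bijective phi -> (forall v, q' v = q (phi v)) ->
  has_model q A -> has_model q' A.
Proof.
move=> phiD bphi qq' [b [t mb]]; exists (b \o phi), t.
have phi0 : phi 0 = 0 by apply: (addrI (phi 0)); rewrite -phiD !addr0.
split=> [v w|v|P cP Pb|||v v0] /=.
- by rewrite phiD; exact: (model_mul mb).
- by rewrite qq'; exact: (model_sqr mb).
- apply: (model_gen mb) => // v; have [psi _ phiK] := bphi.
  by rewrite -[v]phiK; exact: Pb.
- exact: (model_lin mb).
- exact: (model_tr1 mb).
- by rewrite (model_tr0 mb) // -phi0 (inj_eq (bij_inj bphi)).
Qed.

Lemma has_model_trivial (W : zmodType) (q : W -> 'F_2) :
  (forall v : W, v = 0) -> (forall v, q v = 0) -> has_model q F.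
Proof.
move=> W0 q0; exists (fun=> 1), id; split=> //.
- by move=> v w; rewrite mulr1; exact: eqpm_refl.
- by move=> v; rewrite q0 mulr1.
- by move=> P cP _ x; exact: (alg_closedC cP x).
- by move=> v; rewrite (W0 v) eqxx.
Qed.

Section Tensor.

Variables A B : pzAlgType F.

Definition tens (x : A) (y : B) : tensor A B :=
  alg_pi (@tensor_rel F A B) (mmalgU 1 (x, y)).

Let pi := alg_pi (@tensor_rel F A B).

Local Notation e x y := (mmalgU 1 (x, y) : mmalg F (A * B)%type).

Let piB u v : pi (u - v) = pi u - pi v. Proof. exact: rmorphB. Qed.
Let piM u v : pi (u * v) = pi u * pi v. Proof. exact: rmorphM. Qed.

Let pi_rel u v : tensor_rel (u - v) -> pi u = pi v.
Proof. by move=> Suv; apply/eqP/alg_pi_eqP; exact: ideal_gen_rel. Qed.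

Lemma tensDl x x' y : tens (x + x') y = tens x y + tens x' y.
Proof.
apply/eqP; rewrite -subr_eq; apply/eqP; rewrite -[LHS]piB.
apply: pi_rel; rewrite addrAC; exact: tensor_addl.
Qed.

Lemma tensDr x y y' : tens x (y + y') = tens x y + tens x y'.
Proof.
apply/eqP; rewrite -subr_eq; apply/eqP; rewrite -[LHS]piB.
apply: pi_rel; rewrite addrAC; exact: tensor_addr.
Qed.

Lemma tensZl a x y : tens (alg_map a * x) y = alg_map a * tens x y.
Proof.
rewrite -[RHS](piM (alg_map a) (e x y)).
exact/pi_rel/tensor_scalel.
Qed.

Lemma tensZr a x y : tens x (alg_map a * y) = alg_map a * tens x y.
Proof.
rewrite -[RHS](piM (alg_map a) (e x y)).
exact/pi_rel/tensor_scaler.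
Qed.

Lemma tensM x x' y y' : tens x y * tens x' y' = tens (x * x') (y * y').
Proof.
rewrite -[LHS](piM (e x y) (e x' y')) mmalgUM mulr1.
by [].
Qed.

Lemma tens1 : tens 1 1 = 1.
Proof. exact: rmorph1. Qed.

Lemma tens_closed (P : tensor A B -> Prop) :
  alg_closed P -> (forall x, P (tens x 1)) -> (forall y, P (tens 1 y)) ->
  forall u, P u.
Proof.
move=> cP PA PB u; rewrite -[u]alg_piK; elim/mmalg_ind: (repr u) => [|g h|c [x y]].
- by rewrite rmorph0 -(rmorph0 alg_map); exact: alg_closedC.
- by move=> Pg Ph; rewrite rmorphD; exact: alg_closedD.
have -> : mmalgU c (x, y) = mmalgC _ c * mmalgU 1 (x, y) :> mmalg F (A * B)%type.
  by rewrite mmalgUM mulr1 mul1r.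
rewrite -/pi piM; apply: (alg_closedM cP); first exact: (alg_closedC cP c).
have -> : pi (mmalgU 1 (x, y)) = tens x 1 * tens 1 y by rewrite tensM mulr1 mul1r.
exact: alg_closedM.
Qed.

Let oppE (C : pzAlgType F) (z : C) : - z = alg_map (-1) * z.
Proof. by rewrite rmorphN rmorph1 mulN1r. Qed.

Lemma tensNl x y : tens (- x) y = - tens x y.
Proof. by rewrite (oppE x) tensZl -oppE. Qed.

Lemma tensNr x y : tens x (- y) = - tens x y.
Proof. by rewrite (oppE y) tensZr -oppE. Qed.

Lemma eqpm_tens x x' y y' :
  eqpm x x' -> eqpm y y' -> eqpm (tens x y) (tens x' y').
Proof.
by case=> -> [] ->; rewrite ?tensNl ?tensNr ?opprK /eqpm; auto.
Qed.

Lemma tens_sign (c d : 'F_2) :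
  tens ((-1) ^+ c) ((-1) ^+ d) = (-1) ^+ (c + d)%R.
Proof.
rewrite signF2D; case: (F2P c) => ->; case: (F2P d) => ->;
  by rewrite ?tensNl ?tensNr tens1 ?mul1r ?mulr1 ?mulNr ?mulrN ?mulr1.
Qed.

(** The product of two linear forms descends to the tensor product, which is a
    quotient by a two-sided ideal. A form that vanishes on the relations need
    not vanish on the ideal that they generate; but the forms
    p |-> s (k.1 p.1 l.1) * t (k.2 p.2 l.2), for k and l in A * B, all vanish on
    the relations, and multiplying the argument by a pair only changes k
    or l. So they vanish together on the ideal. *)
Lemma tens_form (s : A -> F) (t : B -> F) :
  linear_form s -> linear_form t ->
  exists u : tensor A B -> F, linear_form u /\ forall x y, u (tens x y) = s x * t y.
Proof.
move=> ls lt.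
pose L (k l p : A * B) : F := s (k.1 * p.1 * l.1) * t (k.2 * p.2 * l.2).
have LU k l c p : lin_ext (L k l) (mmalgU c p) = c * L k l p.
  by rewrite lin_extU.
have LC k l a x y : lin_ext (L k l) (alg_map a * e x y) = a * L k l (x, y).
  have -> : alg_map a * e x y = mmalgU a (x, y).
    by rewrite mmalgUM mulr1 mul1r.
  exact: LU.
have L0 k l : lin_ext (L k l) 0 = 0 by exact: raddf0.
have LD k l x y : lin_ext (L k l) (x + y) = lin_ext (L k l) x + lin_ext (L k l) y.
  exact: raddfD.
have LB k l x y : lin_ext (L k l) (x - y) = lin_ext (L k l) x - lin_ext (L k l) y.
  exact: raddfB.
have Ml c p k l x : lin_ext (L k l) (mmalgU c p * x) = c * lin_ext (L (k * p) l) x.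
  elim/mmalg_ind: x => [|g h eg eh|d r].
  - by rewrite mulr0 !L0 mulr0.
  - by rewrite mulrDr !LD mulrDr /= eg eh.
  by rewrite mmalgUM !LU -mulrA /L /= !mulrA.
have Mr c p k l x : lin_ext (L k l) (x * mmalgU c p) = c * lin_ext (L k (p * l)) x.
  elim/mmalg_ind: x => [|g h eg eh|d r].
  - by rewrite mul0r !L0 mulr0.
  - by rewrite mulrDl !LD mulrDr /= eg eh.
  by rewrite mmalgUM !LU [d * c]mulrC -mulrA /L /= !mulrA.
have LI u : ideal_gen (@tensor_rel F A B) u -> forall k l, lin_ext (L k l) u = 0.
  elim=> [_ [x x' y|x y y'|a x y|a x y] k l||x y _ hx _ hy k l|
          a x _ hx k l|a x _ hx k l].
  - rewrite !LB /= !LU /L /= !mul1r.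
    by rewrite mulrDr mulrDl linear_formD // mulrDl addrAC addrK subrr.
  - rewrite !LB /= !LU /L /= !mul1r.
    by rewrite mulrDr mulrDl [t _]linear_formD // mulrDr addrAC addrK subrr.
  - rewrite LB /= LC LU /L /= mul1r.
    rewrite [k.1 * _]mulrA -(alg_mapC a k.1) -!mulrA [s (alg_map a * _)]linear_formZ //.
    by rewrite -mulrA subrr.
  - rewrite LB /= LC LU /L /= mul1r.
    rewrite [k.2 * _]mulrA -(alg_mapC a k.2) -!mulrA [t (alg_map a * _)]linear_formZ //.
    by rewrite mulrCA subrr.
  - by move=> k l; rewrite L0.
  - by rewrite LB hx hy subrr.
  - elim/mmalg_ind: a => [|g h eg eh|c p].
    + by rewrite mul0r L0.
    + by rewrite mulrDl LD eg eh addr0.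
    + by rewrite Ml hx mulr0.
  - elim/mmalg_ind: a => [|g h eg eh|c p].
    + by rewrite mulr0 L0.
    + by rewrite mulrDr LD eg eh addr0.
    + by rewrite Mr hx mulr0.
pose u (x : tensor A B) : F := lin_ext (L 1 1) (repr x).
have uE g : u (pi g) = lin_ext (L 1 1) g.
  apply/eqP; rewrite -subr_eq0 -LB; apply/eqP/LI/alg_pi_eqP.
  by rewrite alg_piK.
exists u; split=> [|x y]; last by rewrite uE LU mul1r /L /= !mul1r !mulr1.
split=> [x y|a x]; rewrite -[x]alg_piK -/pi.
  by rewrite -[y]alg_piK -/pi -rmorphD !uE LD.
rewrite -[alg_map a * _](piM (alg_map a) (repr x)) !uE Ml.
by rewrite mulr1.
Qed.

End Tensor.

Lemma has_model_tensor (W1 W2 : zmodType) (q1 : W1 -> 'F_2) (q2 : W2 -> 'F_2) A B :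
  has_model q1 A -> has_model q2 B ->
  has_model (fun v : W1 * W2 => q1 v.1 + q2 v.2) (tensor A B).
Proof.
move=> [b1 [t1 m1]] [b2 [t2 m2]].
have [t [lt tE]] := tens_form (model_lin m1) (model_lin m2).
exists (fun v => tens (b1 v.1) (b2 v.2)), t; split=> //.
- move=> v w; rewrite tensM; apply: eqpm_tens.
    exact: (model_mul m1).
  exact: (model_mul m2).
- by move=> v; rewrite tensM (model_sqr m1) (model_sqr m2) tens_sign.
- move=> P cP Pb; have Pl x : P (tens x 1).
    apply: (model_gen m1 (P := fun x => P (tens x 1))).
      split=> [a|y z Py Pz|y z Py Pz].
      - by rewrite -[alg_map a]mulr1 tensZl tens1 mulr1; exact: alg_closedC.
      - by rewrite tensDl; exact: alg_closedD.
      - by rewrite -[1]mulr1 -tensM; exact: alg_closedM.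
    move=> v; apply: alg_closed_eqpm cP _ (Pb (v, 0)).
    by apply: eqpm_tens; [left|apply/eqpm_sym/(model0 m2)].
  have Pr y : P (tens 1 y).
    apply: (model_gen m2 (P := fun y => P (tens 1 y))).
      split=> [a|x z Px Pz|x z Px Pz].
      - by rewrite -[alg_map a]mulr1 tensZr tens1 mulr1; exact: alg_closedC.
      - by rewrite tensDr; exact: alg_closedD.
      - by rewrite -[1]mulr1 -tensM; exact: alg_closedM.
    move=> v; apply: alg_closed_eqpm cP _ (Pb (0, v)).
    by apply: eqpm_tens; [apply/eqpm_sym/(model0 m1)|left].
  exact: tens_closed.
- by rewrite -tens1 tE (model_tr1 m1) (model_tr1 m2) mulr1.
- move=> [v w]; rewrite -pair_eqE negb_and tE /= => /orP[v0|w0].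
    by rewrite (model_tr0 m1) ?mul0r.
  by rewrite (model_tr0 m2) ?mulr0.
Qed.

End Constructions.

(** * Direct powers and characters of F_2^m *)

Section DirectPower.

Variables (F : fieldType) (rho : nat).
Hypothesis two_neq0 : (2%:R : F) != 0.

Local Notation vec := {ffun 'I_rho -> 'F_2}.

Definition dot (c s : vec) : 'F_2 := \sum_j c j * s j.

Definition chi (c s : vec) : F := (-1) ^+ dot c s.

Lemma chiC c s : chi c s = chi s c.
Proof. by congr ((-1) ^+ _); congr nat_of_ord; apply: eq_bigr => j _; rewrite mulrC. Qed.

Lemma chiDr c s s' : chi c (s + s') = chi c s * chi c s'.
Proof.
rewrite /chi -(signF2D F) -big_split; congr ((-1) ^+ _); congr nat_of_ord.
by apply: eq_bigr => j _; rewrite ffunE mulrDr.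
Qed.

Lemma chiDl c c' s : chi (c + c') s = chi c s * chi c' s.
Proof. by rewrite !(chiC _ s) chiDr. Qed.

Lemma chi0 c : chi c 0 = 1.
Proof. by rewrite /chi /dot big1 // => j _; rewrite ffunE mulr0. Qed.

Lemma chi_sqr c s : chi c s * chi c s = 1.
Proof. by rewrite /chi -expr2 sqrr_sign. Qed.

(** For c != 0 some u has chi c u = -1, and translating by u shows that the sum is
    its own opposite. *)
Lemma chi_sum c : \sum_s chi c s = (2 ^ rho)%:R *+ (c == 0).
Proof.
have [->|] := eqVneq c 0.
  under eq_bigr do rewrite chiC chi0.
  by rewrite sumr_const card_ffun card_Fp // card_ord.
move=> c0; have /existsP[j cj] : [exists j, c j != 0].
  apply: contraNT c0; rewrite negb_exists => /forallP c0.
  by apply/eqP/ffunP => j; rewrite ffunE; apply/eqP/negPn.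
pose u : vec := [ffun k => (k == j)%:R].
have chiu : chi c u = -1.
  rewrite /chi (_ : dot c u = c j); first by case: (F2P (c j)) cj => ->.
  rewrite /dot (bigD1 j) // big1 => [|k /negPf kj]; last by rewrite ffunE kj mulr0.
  by rewrite ffunE eqxx mulr1; exact: addr0.
have : \sum_s chi c s = - \sum_s chi c s.
  rewrite {1}(reindex_inj (addIr u)) /= -mulN1r mulr_sumr; apply: eq_bigr => s _.
  by rewrite chiDr chiu mulrC.
move/eqP; rewrite -addr_eq0 -mulr2n -[_ *+ 2]mulr_natr mulf_eq0 (negPf two_neq0) orbF.
by move/eqP->.
Qed.

Lemma card_vec : #|{: vec}| = (2 ^ rho)%N.
Proof. by rewrite card_ffun card_Fp // card_ord. Qed.

(** The factors of a direct power are numbered, while the characters are indexed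
    by vectors. *)
Definition vec_of (i : 'I_(2 ^ rho)) : vec := enum_val (cast_ord (esym card_vec) i).

Lemma vec_of_bij : bijective vec_of.
Proof.
exists (fun s => cast_ord card_vec (enum_rank s)) => [i|s]; rewrite /vec_of.
  by rewrite enum_valK cast_ordKV.
by rewrite cast_ordK enum_rankK.
Qed.

Let pow2_neq0 : ((2 ^ rho)%:R : F) != 0.
Proof. by rewrite natrX expf_neq0. Qed.

Variables (W : zmodType) (q : W -> 'F_2) (A : pzAlgType F).
Variables (l : vec -> F) (q' : vec -> 'F_2).
Hypothesis l_mul : forall c d, eqpm (l c * l d) (l (c + d)).
Hypothesis l_sqr : forall c, l c * l c = (-1) ^+ q' c.

(** The pair (v, c) acts on the factor of index s by l c * chi c s * b v. For
    l = 1 the vectors c span a radical on which the form is zero. A scalar factor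
    l c with square (-1)^(q' c) puts the form q' on these vectors. *)
Lemma has_model_direct_pow :
  has_model q A ->
  has_model (fun v : W * vec => q v.1 + q' v.2) (direct_pow (2 ^ rho) A).
Proof.
move=> [b [t mb]]; have lt := model_lin mb.
pose D := direct_pow (2 ^ rho) A.
pose b' (v : W * vec) : D :=
  [ffun i => alg_map (l v.2 * chi v.2 (vec_of i)) * b v.1].
pose t' (x : D) : F := (2 ^ rho)%:R^-1 * \sum_i t ((x : {ffun _ -> A}) i).
have alg_mapE a i : ((alg_map a : D) : {ffun _ -> A}) i = alg_map a by rewrite ffunE.
have addE (x y : D) i : ((x + y : D) : {ffun _ -> A}) i =
  (x : {ffun _ -> A}) i + (y : {ffun _ -> A}) i by rewrite ffunE.
have mulE (x y : D) i : ((x * y : D) : {ffun _ -> A}) i =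
  (x : {ffun _ -> A}) i * (y : {ffun _ -> A}) i by rewrite ffunE.
have oppE (x : D) i : ((- x : D) : {ffun _ -> A}) i =
  - (x : {ffun _ -> A}) i by rewrite ffunE.
have swap (a c : F) (x y : A) :
    alg_map a * x * (alg_map c * y) = alg_map (a * c) * (x * y).
  by rewrite rmorphM -!mulrA [x * (_ * y)]mulrA -(alg_mapC c x) !mulrA.
have bE k v i : ((alg_map k * b' v : D) : {ffun _ -> A}) i =
    alg_map (k * (l v.2 * chi v.2 (vec_of i))) * b v.1.
  by rewrite mulE alg_mapE ffunE [in RHS]rmorphM mulrA.
exists b', t'; split.
- move=> v w.
  have : eqpm (b v.1 * b w.1) (b (v.1 + w.1)) := model_mul mb _ _.
  have : eqpm (l v.2 * l w.2) (l (v.2 + w.2)) := l_mul _ _.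
  have E : b' v * b' w = [ffun i =>
      alg_map (l v.2 * l w.2 * chi (v.2 + w.2) (vec_of i)) * (b v.1 * b w.1)].
    apply/ffunP => i; rewrite mulE !ffunE swap chiDl; congr (alg_map _ * _).
    by rewrite mulrACA.
  have E' : b' (v + w) = [ffun i =>
      alg_map (l (v.2 + w.2) * chi (v.2 + w.2) (vec_of i)) * b (v.1 + w.1)] by [].
  rewrite E E'; case=> -> [] ->; [left|right|right|left];
    apply/ffunP => i; rewrite !ffunE ?(mulrN, mulNr, rmorphN) ?opprK //=.
- move=> v; apply/ffunP => i; rewrite mulE !ffunE swap (model_sqr mb).
  have -> : ((-1) ^+ (q v.1 + q' v.2)%R : D) = alg_map ((-1) ^+ (q v.1 + q' v.2)%R).
    by rewrite rmorphXn rmorphN rmorph1.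
  rewrite alg_mapE mulrACA chi_sqr mulr1 l_sqr signF2D rmorphM alg_mapC.
  by rewrite !rmorphXn !rmorphN !rmorph1.
- move=> P cP Pb.
  pose cst x : D := [ffun=> x].
  have Pcst x : P (cst x).
    apply: (model_gen mb (P := fun x => P (cst x))).
      split=> [a|y z Py Pz|y z Py Pz].
      - exact: (alg_closedC cP a).
      - rewrite (_ : cst _ = cst y + cst z); first exact: alg_closedD.
        by apply/ffunP => i; rewrite !ffunE.
      - rewrite (_ : cst _ = cst y * cst z); first exact: alg_closedM.
        by apply/ffunP => i; rewrite !ffunE.
    move=> v; apply: (alg_closed_eqpm cP _ (alg_closedZ (l 0) cP (Pb (v, 0)))).
    have : eqpm (l 0 * l 0) 1.
      by rewrite l_sqr -[_ ^+ _]mulr1; exact: eqpm_sign.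
    case=> l0; [left|right]; apply/ffunP => i;
      rewrite [LHS]ffunE ?oppE bE chiC chi0 mulr1 /= l0 ?rmorphN rmorph1 ?mulN1r ?mul1r //.
    by rewrite opprK.
  pose ch c : D := [ffun i => alg_map (chi c (vec_of i))].
  have Pch c : P (ch c).
    have : eqpm (ch c) (alg_map (l c) * b' (0, c)).
      have : eqpm (l c * l c) 1.
        by rewrite l_sqr -[_ ^+ _]mulr1; exact: eqpm_sign.
      have := model0 mb.
      by case=> b0 [] lc; [left|right|right|left]; apply/ffunP => i;
        rewrite [LHS]ffunE ?oppE bE mulrA /= b0 lc
          ?(mulNr, mulrN, mul1r, mulr1, rmorphN) ?opprK.
    by move/(alg_closed_eqpm cP); apply; apply: alg_closedZ.
  (* The idempotents of the factors, by Fourier inversion. *)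
  pose delta i : D := [ffun j => (j == i)%:R].
  have Pdelta i : P (delta i).
    rewrite (_ : delta i = alg_map (2 ^ rho)%:R^-1 *
                  \sum_c alg_map (chi c (vec_of i)) * ch c).
      apply: (alg_closedZ _ cP); apply: (alg_closed_sum _ cP) => c.
      exact: (alg_closedZ _ cP).
    apply/ffunP => j; rewrite mulE alg_mapE sum_ffunE ffunE.
    under eq_bigr => c _ do rewrite mulE alg_mapE ffunE -rmorphM -chiDr chiC.
    rewrite -rmorph_sum chi_sum -rmorphM mulrnAr mulVf // rmorphMn rmorph1.
    rewrite addr_eq0 (_ : - vec_of j = vec_of j); last first.
      by apply/ffunP => k; rewrite ffunE; case: (F2P (vec_of j k)) => ->; apply/val_inj.
    by rewrite (inj_eq (bij_inj vec_of_bij)) eq_sym.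
  move=> x; rewrite (_ : x = \sum_i delta i * cst ((x : {ffun _ -> A}) i)).
    by apply: alg_closed_sum => // i; exact: alg_closedM.
  apply/ffunP => j; rewrite sum_ffunE (bigD1 j) //= big1 => [|i /negPf ij].
    by rewrite mulE !ffunE eqxx mul1r addr0.
  by rewrite mulE !ffunE eq_sym ij mul0r.
- split=> [x y|a x]; rewrite /t'.
    rewrite -mulrDr -big_split; congr (_ * _); apply: eq_bigr => i _.
    by rewrite addE linear_formD.
  rewrite mulrCA; congr (_ * _); rewrite mulr_sumr; apply: eq_bigr => i _.
  by rewrite mulE alg_mapE linear_formZ.
- rewrite /t' (eq_bigr (fun=> 1)) => [|i _]; last by rewrite ffunE (model_tr1 mb).
  by rewrite sumr_const card_ord mulVf.
- move=> [v c]; rewrite -pair_eqE negb_and /= => vc; rewrite /t'.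
  under eq_bigr => i _ do rewrite ffunE linear_formZ // mulrAC /=.
  rewrite -mulr_sumr.
  have [v0|v0] := eqVneq v 0; last by rewrite (model_tr0 mb v0) mulr0 mul0r mulr0.
  rewrite v0 eqxx /= in vc.
  have -> : \sum_i chi c (vec_of i) = \sum_s chi c s.
    by rewrite [RHS](reindex vec_of) //; exact/onW_bij/vec_of_bij.
  by rewrite chi_sum (negPf vc) !mulr0.
Qed.

End DirectPower.

Section FfunSplit.

Variables (S : zmodType) (k : nat).

Definition ffun_split (f : {ffun 'I_k.+1 -> S}) : S * {ffun 'I_k -> S} :=
  (f ord0, [ffun i => f (lift ord0 i)]).

Definition ffun_join (u : S * {ffun 'I_k -> S}) : {ffun 'I_k.+1 -> S} :=
  [ffun i => oapp u.2 u.1 (unlift ord0 i)].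

Lemma ffun_splitD : {morph ffun_split : f g / f + g}.
Proof.
move=> f g; congr (_, _); first by rewrite ffunE.
by apply/ffunP => i; rewrite !ffunE.
Qed.

Lemma ffun_splitK : cancel ffun_split ffun_join.
Proof.
move=> f; apply/ffunP => i; rewrite ffunE.
by case: unliftP => [j|] -> //=; rewrite ffunE.
Qed.

Lemma ffun_joinK : cancel ffun_join ffun_split.
Proof.
move=> [x f]; congr (_, _); first by rewrite ffunE unlift_none.
by apply/ffunP => i; rewrite !ffunE liftK.
Qed.

End FfunSplit.

(** * Matrices, quaternions and F[i] *)

(** The form c x^2 + x y + d y^2: squares are left out since x^2 = x on F_2. It
    is of minus type for c = d = 1 and of plus type otherwise. *)
Definition plane_form (c d : 'F_2) (v : 'F_2 * 'F_2) : 'F_2 :=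
  c * v.1 + v.1 * v.2 + d * v.2.

Definition line_form (a : 'F_2) : 'F_2 := a ^+ 2.

Local Notation planes k := {ffun 'I_k -> 'F_2 * 'F_2}.

(** The orthogonal sum of k planes of plus type, in coordinates. *)
Definition hyp_form k (w : planes k) : 'F_2 := \sum_i plane_form 0 0 (w i).

Section ConcreteAlgebras.

Variable F : fieldType.

(** Two anticommuting generators, with prescribed signs as squares, give a model
    of a plane: the vector (a, b) acts by x^a y^b. *)
Lemma has_model_plane (A : pzAlgType F) (x y : A) (t : A -> F) (c d : 'F_2) :
  x * x = (-1) ^+ c -> y * y = (-1) ^+ d -> x * y = - (y * x) ->
  (forall P, alg_closed P -> P x -> P y -> forall z, P z) ->
  linear_form t -> t 1 = 1 -> t x = 0 -> t y = 0 -> t (x * y) = 0 ->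
  has_model (plane_form c d) A.
Proof.
move=> xx yy xy gen_xy lt t1 tx ty txy.
exists (fun v : 'F_2 * 'F_2 => x ^+ v.1 * y ^+ v.2), t.
have pow2 (z : A) (a b e : 'F_2) : z * z = (-1) ^+ e ->
    eqpm (z ^+ a * z ^+ b) (z ^+ (a + b)%R).
  move=> zz; case: (F2P a) => ->; first by rewrite mul1r add0r; left.
  case: (F2P b) => ->; first by rewrite mulr1 addr0; left.
  by rewrite [_ * _]zz -[X in eqpm X _]mulr1; exact: eqpm_sign.
split=> //.
- move=> [a1 a2] [b1 b2] /=.
  apply: eqpm_trans (eqpmM (pow2 x a1 b1 _ xx) (pow2 y a2 b2 _ yy)).
  rewrite -!mulrA; apply: eqpmM (eqpm_refl _) _; rewrite !mulrA.
  apply: eqpmM _ (eqpm_refl _).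
  case: (F2P a2) => ->; first by rewrite mul1r mulr1; left.
  case: (F2P b1) => ->; first by rewrite mul1r mulr1; left.
  by right; rewrite /= !expr1 xy opprK.
- move=> [a b]; rewrite /plane_form; cbn [fst snd].
  case: (F2P a) => ->; case: (F2P b) => ->.
  + by rewrite !(mulr0, addr0, mulr1).
  + by rewrite !(mulr0, mul0r, add0r, mulr1, mul1r).
  + by rewrite !(mulr0, mul0r, addr0, mulr1, mul1r).
  + rewrite !expr1 !mulr1 !signF2D -yy -xx expr1 mulrN1 mulNr.
    by rewrite mulrA -[x * y * x]mulrA -[y * x]opprK -xy mulrN mulNr !mulrA.
- move=> P cP Pb; apply: gen_xy => //.
    by have := Pb (1, 0); rewrite /= expr1 expr0 mulr1.
  by have := Pb (0, 1); rewrite /= expr1 expr0 mul1r.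
- move=> [a b]; rewrite /=.
  case: (F2P a) => ->; case: (F2P b) => -> /=;
    by rewrite ?expr1 ?expr0 ?mul1r ?mulr1.
Qed.

Lemma has_model_line (A : pzAlgType F) (x : A) (t : A -> F) :
  x * x = -1 -> (forall P, alg_closed P -> P x -> forall z, P z) ->
  linear_form t -> t 1 = 1 -> t x = 0 ->
  has_model line_form A.
Proof.
move=> xx gen_x lt t1 tx; exists (fun a : 'F_2 => x ^+ a), t; split=> //.
- move=> a b; case: (F2P a) => ->; first by rewrite mul1r add0r; left.
  case: (F2P b) => ->; first by rewrite mulr1 addr0; left.
  by right; rewrite /= expr1 xx.
- by move=> a; case: (F2P a) => ->; rewrite ?mulr1 //= expr1 xx.
- by move=> P cP Pb; apply: gen_x => //; exact: (Pb 1).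
- by move=> a; case: (F2P a) => ->; rewrite ?eqxx //= expr1.
Qed.

Hypothesis two_neq0 : (2%:R : F) != 0.

Definition mx2 (a b c d : F) : M2 F :=
  \matrix_(i < 2, j < 2) if i == 0 then if j == 0 then a else b
                         else if j == 0 then c else d.

Lemma mx2P (x : M2 F) : exists a b c d, x = mx2 a b c d.
Proof.
exists ((x : 'M_2) 0 0), ((x : 'M_2) 0 1), ((x : 'M_2) 1 0), ((x : 'M_2) 1 1).
apply/matrixP => i j; rewrite mxE.
by case: i => [[|[|//]] ?]; case: j => [[|[|//]] ?]; congr (fun_of_matrix x _ _); apply: val_inj.
Qed.

Lemma mx2M a b c d a' b' c' d' : mx2 a b c d * mx2 a' b' c' d' =
  mx2 (a * a' + b * c') (a * b' + b * d') (c * a' + d * c') (c * b' + d * d').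
Proof.
apply/matrixP => i j; rewrite !mxE !big_ord_recl big_ord0 addr0 !mxE.
by case: i => [[|[|//]] ?]; case: j => [[|[|//]] ?].
Qed.

Lemma mx2D a b c d a' b' c' d' : mx2 a b c d + mx2 a' b' c' d' =
  mx2 (a + a') (b + b') (c + c') (d + d').
Proof.
apply/matrixP => i j; rewrite !mxE.
by case: i => [[|[|//]] ?]; case: j => [[|[|//]] ?].
Qed.

Lemma mx2N a b c d : - mx2 a b c d = mx2 (- a) (- b) (- c) (- d).
Proof.
apply/matrixP => i j; rewrite !mxE.
by case: i => [[|[|//]] ?]; case: j => [[|[|//]] ?].
Qed.

Lemma mx2C a : alg_map a = mx2 a 0 0 a.
Proof.
apply/matrixP => i j; rewrite !mxE.
by case: i => [[|[|//]] ?]; case: j => [[|[|//]] ?].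
Qed.

Lemma mx2_1 : 1 = mx2 1 0 0 1.
Proof. by rewrite -mx2C rmorph1. Qed.

Definition half_tr (x : M2 F) : F := 2%:R^-1 * \tr (x : 'M_2).

Lemma half_trE a b c d : half_tr (mx2 a b c d) = 2%:R^-1 * (a + d).
Proof. by rewrite /half_tr /mxtrace !big_ord_recl big_ord0 addr0 !mxE. Qed.

Lemma half_tr_form : linear_form half_tr.
Proof.
split=> [x y|a x]; rewrite /half_tr.
  by rewrite linearD mulrDr.
rewrite [RHS]mulrCA -[a * _]mxtraceZ -[a *: _]mul_scalar_mx; congr (_ * _).
Qed.

Lemma half_tr1 : half_tr 1 = 1.
Proof. by rewrite mx2_1 half_trE; exact: mulVf. Qed.

(** The identity, these two matrices and their product form a basis of the matrix
    algebra, since 2 is invertible. *)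
Lemma M2_gen (P : M2 F -> Prop) : alg_closed P ->
  P (mx2 1 0 0 (-1)) -> P (mx2 0 1 1 0) -> forall z, P z.
Proof.
move=> cP Px Py z; have [a [b [c [d ->]]]] := mx2P z.
pose h := 2%:R^-1 : F.
have -> : mx2 a b c d = alg_map (h * (a + d)) + alg_map (h * (a - d)) * mx2 1 0 0 (-1)
   + (alg_map (h * (b + c)) + alg_map (h * (b - c)) * mx2 1 0 0 (-1)) * mx2 0 1 1 0.
  rewrite !mx2C !(mx2M, mx2D).
  by congr mx2; rewrite /h; field.
by do ?[apply: (alg_closedD cP) | apply: (alg_closedM cP) | apply: (alg_closedC cP)].
Qed.

Lemma M2_plus : has_model (plane_form 0 0) (M2 F).
Proof.
apply: (@has_model_plane _ (mx2 1 0 0 (-1)) (mx2 0 1 1 0) half_tr).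
- by rewrite expr0 mx2_1 mx2M; congr mx2; ring.
- by rewrite expr0 mx2_1 mx2M; congr mx2; ring.
- by rewrite !mx2M mx2N; congr mx2; ring.
- exact: M2_gen.
- exact: half_tr_form.
- exact: half_tr1.
- by rewrite half_trE subrr mulr0.
- by rewrite half_trE addr0 mulr0.
- by rewrite mx2M half_trE; ring.
Qed.

(** If x^2 + y^2 = -1, the quaternion algebra splits: the matrices below are
    anticommuting square roots of -1. *)
Lemma M2_minus (p s : F) : p ^+ 2 + s ^+ 2 = -1 ->
  has_model (plane_form 1 1) (M2 F).
Proof.
move=> ps; have s2 : s ^+ 2 = -1 - p ^+ 2 by rewrite -ps addrC addKr.
apply: (@has_model_plane _ (mx2 0 1 (-1) 0) (mx2 p s s (-p)) half_tr).
- by rewrite expr1 mx2_1 mx2N mx2M; congr mx2; ring.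
- by rewrite expr1 mx2_1 mx2N mx2M; congr mx2; ring: s2.
- by rewrite !mx2M mx2N; congr mx2; ring.
- move=> P cP Px Py; apply: M2_gen => //.
    have -> : mx2 1 0 0 (-1) =
        (alg_map (- p) + alg_map (- s) * mx2 0 1 (-1) 0) * mx2 p s s (-p).
      by rewrite (mx2C (- p)) (mx2C (- s)) !(mx2M, mx2D); congr mx2; ring: s2.
    by do ?[apply: (alg_closedD cP) | apply: (alg_closedM cP) | apply: (alg_closedC cP)].
  have -> : mx2 0 1 1 0 =
      (alg_map (- s) + alg_map p * mx2 0 1 (-1) 0) * mx2 p s s (-p).
    by rewrite (mx2C (- s)) (mx2C p) !(mx2M, mx2D); congr mx2; ring: s2.
  by do ?[apply: (alg_closedD cP) | apply: (alg_closedM cP) | apply: (alg_closedC cP)].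
- exact: half_tr_form.
- exact: half_tr1.
- by rewrite half_trE addr0 mulr0.
- by rewrite half_trE subrr mulr0.
- by rewrite mx2M half_trE; ring.
Qed.

Lemma tensor_pow_M2 k : has_model (@hyp_form k) (tensor_pow (M2 F) k).
Proof.
elim: k => [|k IHk].
  apply: has_model_trivial => v; last exact: big_ord0.
  by apply/ffunP => -[].
apply: (has_model_transport (@ffun_splitD _ k) _ _ (has_model_tensor M2_plus IHk)) => [|v].
  by exists (@ffun_join _ k); [exact: ffun_splitK | exact: ffun_joinK].
by rewrite /hyp_form big_ord_recl; congr (_ + _); apply: eq_bigr => i _; rewrite ffunE.
Qed.

End ConcreteAlgebras.

Section AdjoinI.

Import Pdiv.CommonRing Pdiv.RingMonic.

Variable F : fieldType.

Local Notation p := ('X^2 + 1 : {poly F}).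
Local Notation pi := (in_qpoly p).

Lemma adjoin_i_model : has_model line_form (adjoin_i F).
Proof.
have size_p : size p = 3 by rewrite size_polyDl ?size_polyXn ?size_poly1.
have coefC a (x : adjoin_i F) : (alg_map a * x : {poly %/ p}) = a *: (x : {poly F}) :> {poly F}.
  rewrite poly_of_qpolyM mul_polyC rmodp_small //.
  by apply: leq_ltn_trans (size_scale_leq _ _) (size_mk_monic _).
apply: (@has_model_line _ _ ('qX : {poly %/ p}) (fun x => (x : {poly %/ p})`_0)).
- apply/eqP; rewrite -addr_eq0; apply/eqP.
  have <- : pi ('X^2 + 1) = 0.
    apply: val_inj; rewrite /= adjoin_i_modulus rmodpp // -adjoin_i_modulus.
    exact: monic_mk_monic.
  by rewrite in_qpolyD in_qpoly1 expr2 in_qpolyM.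
- move=> P cP PX z; have -> : z = pi (z : {poly %/ p}).
    by apply: val_inj; rewrite /= rmodp_small // size_mk_monic.
  elim/poly_ind: (z : {poly F}) => [|g c Pg].
    have -> : pi 0 = alg_map 0 :> adjoin_i F by rewrite in_qpoly0 rmorph0.
    exact: alg_closedC.
  rewrite in_qpolyD; apply: (alg_closedD cP).
    by rewrite in_qpolyM; exact: (alg_closedM cP).
  rewrite (_ : pi _ = alg_map c); first exact: (alg_closedC cP).
  apply: val_inj; rewrite /= rmodp_small // adjoin_i_modulus size_p.
  exact: leq_ltn_trans (size_polyC_leq1 _) _.
- by split=> [x y|a x]; [rewrite coefD | rewrite coefC coefZ].
- by rewrite coef1.
- have monic_p : p \is monic by rewrite -adjoin_i_modulus monic_mk_monic.
  by rewrite qpolyXE ?size_p // coefX.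
Qed.

End AdjoinI.

Section Quaternions.

Variable F : fieldType.
Hypothesis two_neq0 : (2%:R : F) != 0.

(** The form t cannot be read off a presentation by generators and relations. It
    is pulled back from the tensor square of M(2,F): the minus plane embeds into
    the orthogonal sum of two plus planes, so this algebra contains
    anticommuting square roots of -1. *)
Lemma quaternion_model : has_model (plane_form 1 1) (quaternion F).
Proof.
pose S := @quaternion_rel F.
have [b [t mb]] := has_model_tensor (M2_plus two_neq0) (M2_plus two_neq0).
have lt := model_lin mb.
(* Both vectors have value 1, and they are not orthogonal. *)
pose v c : ('F_2 * 'F_2) * ('F_2 * 'F_2) :=
  if c then ((1, 1), (0, 0)) else ((1, 0), (1, 1)).
have bsqr c : b (v c) * b (v c) = -1 by rewrite (model_sqr mb); case: c.
have bcomm : b (v true) * b (v false) = - (b (v false) * b (v true)).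
  rewrite (model_comm mb) (_ : polar _ _ _ = 1); last exact/val_inj.
  by rewrite expr1 mulN1r.
have [h [hg hC]] := free_morph (fun c => b (v c)).
have [|f [fE fC]] := @alg_quot_lift _ _ _ S h hC.
  move=> _ [c|]; rewrite rmorphD.
    by rewrite rmorph1 expr2 rmorphM hg bsqr addNr.
  by rewrite !(rmorphM h) !hg bcomm addNr.
pose g c : quaternion F := alg_pi S (gen F c).
have fg c : f (g c) = b (v c) by rewrite -hg -fE.
have piD x y : alg_pi S (x + y) = alg_pi S x + alg_pi S y by exact: rmorphD.
have piM x y : alg_pi S (x * y) = alg_pi S x * alg_pi S y by exact: rmorphM.
have pi_rel u : S u -> alg_pi S u = 0.
  move=> Su; rewrite -[RHS](rmorph0 (alg_pi S)); apply/eqP/alg_pi_eqP.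
  by rewrite subr0; exact: ideal_gen_rel.
have gsqr c : g c * g c = -1.
  apply/eqP; rewrite -addr_eq0 -piM -[1](rmorph1 (alg_pi S)) -piD -expr2.
  by apply/eqP/pi_rel; exact: quaternion_sqr.
have lf : linear_form (fun x => t (f x)).
  split=> [x y|a x]; first by rewrite rmorphD linear_formD.
  by rewrite rmorphM fC linear_formZ.
apply: (@has_model_plane _ _ (g true) (g false) (fun x => t (f x))) => //.
- apply/eqP; rewrite -addr_eq0 -!piM -piD.
  by apply/eqP/pi_rel; exact: quaternion_anticomm.
- move=> P cP Pt Pf x; rewrite -[x]alg_piK.
  by apply: (malg_free_ind (alg_quot_closed cP)) => -[].
- by rewrite rmorph1 (model_tr1 mb).
- by rewrite fg (model_tr0 mb).
- by rewrite fg (model_tr0 mb).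
- rewrite rmorphM !fg.
  by case: (model_mul mb (v true) (v false)) => ->;
    rewrite ?linear_formN // (model_tr0 mb) ?oppr0.
Qed.

End Quaternions.

(** * Orthogonal sums in coordinates *)

Section Isometries.

Definition isometric (W W' : zmodType) (q : W -> 'F_2) (q' : W' -> 'F_2) : Prop :=
  exists phi : W -> W',
    [/\ {morph phi : v w / v + w}, bijective phi & forall v, q' (phi v) = q v].

Definition nondegenerate (W : zmodType) (q : W -> 'F_2) : Prop :=
  forall v, (forall w, polar q v w = 0) -> v = 0.

Definition rad_trivial (W : zmodType) (q : W -> 'F_2) : Prop :=
  forall v, (forall w, polar q v w = 0) -> q v = 0 -> v = 0.

Lemma isometric_sym (W W' : zmodType) (q : W -> 'F_2) (q' : W' -> 'F_2) :
  isometric q q' -> isometric q' q.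
Proof.
move=> [phi [phiD [psi phiK psiK] qE]]; exists psi; split=> [v w||v].
- by apply: (can_inj phiK); rewrite phiD !psiK.
- by exists phi.
- by rewrite -qE psiK.
Qed.

Lemma has_model_isometric (F : fieldType) (W W' : zmodType)
    (q : W -> 'F_2) (q' : W' -> 'F_2) (A : pzAlgType F) :
  isometric q q' -> has_model q A -> has_model q' A.
Proof.
move=> /isometric_sym[phi [phiD bphi qE]].
by apply: (has_model_transport phiD bphi) => v; rewrite qE.
Qed.

Lemma addFF (x : 'F_2) : x + x = 0.
Proof. by case: (F2P x) => ->; apply/val_inj. Qed.

Lemma polar_0r (W : zmodType) (q : W -> 'F_2) v : q 0 = 0 -> polar q v 0 = 0.
Proof. by move=> q0; rewrite /polar addr0 q0 addr0 addFF. Qed.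

Lemma polar_0l (W : zmodType) (q : W -> 'F_2) v : q 0 = 0 -> polar q 0 v = 0.
Proof. by move=> q0; rewrite /polar add0r q0 addr0 addFF. Qed.

Lemma polar_pair (W W' : zmodType) (q : W -> 'F_2) (q' : W' -> 'F_2) (v w : W * W') :
  polar (fun v => q v.1 + q' v.2) v w = polar q v.1 w.1 + polar q' v.2 w.2.
Proof. by rewrite /polar /= [X in X + _ = _]addrACA [LHS]addrACA. Qed.

Lemma morph_polar (W W' : zmodType) (q : W -> 'F_2) (q' : W' -> 'F_2) (phi : W -> W') v w :
  {morph phi : v w / v + w} -> (forall v, q' (phi v) = q v) ->
  polar q' (phi v) (phi w) = polar q v w.
Proof. by move=> phiD qE; rewrite /polar -phiD !qE. Qed.

Lemma isometric_nondeg (W W' : zmodType) (q : W -> 'F_2) (q' : W' -> 'F_2) :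
  isometric q q' -> nondegenerate q -> nondegenerate q'.
Proof.
move=> /isometric_sym[phi [phiD [psi phiK psiK] qE]] nd v h; apply: (can_inj phiK).
have -> : phi 0 = 0 by apply: (addrI (phi 0)); rewrite -phiD !addr0.
apply: nd => w; rewrite -[w]psiK; apply: etrans (h (psi w)).
exact: morph_polar.
Qed.

(** The kernel of an isometric additive map lies in the radical. This replaces
    the directness of an orthogonal decomposition by a property of the form. *)
Lemma isometry_inj (W W' : zmodType) (q : W -> 'F_2) (q' : W' -> 'F_2) (phi : W -> W') :
  {morph phi : v w / v + w} -> (forall v, q' (phi v) = q v) ->
  q 0 = 0 -> rad_trivial q -> injective phi.
Proof.
move=> phiD qE q0 rq.
have phi0 : phi 0 = 0 by apply: (addrI (phi 0)); rewrite -phiD !addr0.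
have phiB v w : phi (v - w) = phi v - phi w.
  by apply/eqP; rewrite eq_sym subr_eq -phiD subrK.
move=> v w vw; apply/eqP; rewrite -subr_eq0; apply/eqP.
have d0 : phi (v - w) = phi 0 by rewrite phiB vw subrr phi0.
apply: rq => [u|]; last by rewrite -qE d0 qE.
rewrite -(morph_polar _ _ phiD qE) d0 (morph_polar _ _ phiD qE).
by rewrite /polar add0r q0 addr0 addFF.
Qed.

Lemma plane_form_nondeg c d : nondegenerate (plane_form c d).
Proof.
move=> [a b] h; have := h (1, 0); have := h (0, 1).
case: (F2P a) => ->; case: (F2P b) => -> //; case: (F2P c) => ->; case: (F2P d) => ->.
all: by move=> /(congr1 val) /= ? /(congr1 val) /=.
Qed.

Section SumForm.

Variable k : nat.

Lemma polar_hyp_form v w :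
  polar (@hyp_form k) v w = \sum_i polar (plane_form 0 0) (v i) (w i).
Proof.
by rewrite /polar /hyp_form -!big_split; apply: eq_bigr => i _; rewrite ffunE.
Qed.

(** Testing against vectors supported at i isolates the i-th plane. *)
Lemma hyp_form_nondeg : nondegenerate (@hyp_form k).
Proof.
move=> w h; apply/ffunP => i; rewrite ffunE.
apply: (@plane_form_nondeg 0 0) => y.
apply: etrans _ (h [ffun j => if j == i then y else 0]).
rewrite polar_hyp_form (bigD1 i) // big1 => [|j /negPf ij].
  by rewrite ffunE eqxx; symmetry; exact: addr0.
by rewrite ffunE ij; apply: polar_0r; apply/val_inj.
Qed.

Variables (X : zmodType) (q0 : X -> 'F_2).

Definition orth_sum (w : planes k * X) : 'F_2 := hyp_form w.1 + q0 w.2.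

Lemma hyp_form0 : hyp_form (0 : planes k) = 0.
Proof. by rewrite /hyp_form big1 // => i _; rewrite ffunE; apply/val_inj. Qed.

Hypothesis q00 : q0 0 = 0.

Lemma orth_sum_polar_rad v : (forall w, polar orth_sum v w = 0) ->
  v.1 = 0 /\ forall x, polar q0 v.2 x = 0.
Proof.
move=> h; split=> [|x].
  apply: hyp_form_nondeg => w; apply: etrans _ (h (w, 0)); rewrite polar_pair /=.
  by rewrite (polar_0r _ q00) addr0.
by apply: etrans _ (h (0, x)); rewrite polar_pair /= (polar_0r _ hyp_form0) add0r.
Qed.

Lemma orth_sum_nondeg : nondegenerate q0 -> nondegenerate orth_sum.
Proof.
move=> nq [w x] /orth_sum_polar_rad [/= -> /nq ->].
by [].
Qed.

Lemma orth_sum_rad : rad_trivial q0 -> rad_trivial orth_sum.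
Proof.
move=> rq [w x] /orth_sum_polar_rad [/= -> h]; rewrite /orth_sum /= hyp_form0 add0r.
by move/rq => ->.
Qed.

End SumForm.

Section PlaneDecomposition.

Variables (T : vectType 'F_2) (Q : quad_form T).
Variables (k : nat) (U : 'I_k -> {vspace T}) (R : {vspace T}).
Variables (X : zmodType) (q0 : X -> 'F_2) (p0 : X -> T).
Hypothesis full : (\sum_i U i + R = fullv)%VS.
Hypothesis planeU : forall i, plus_plane Q (U i).
Hypothesis orthU : forall i j, i != j ->
  forall v w, v \in U i -> w \in U j -> polar Q v w = 0.
Hypothesis orthR : forall i v w, v \in U i -> w \in R -> polar Q v w = 0.
Hypothesis p0D : {morph p0 : x y / x + y}.
Hypothesis p0R : forall x, p0 x \in R.
Hypothesis p0_surj : forall v, v \in R -> exists x, v = p0 x.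
Hypothesis p0q : forall x, Q (p0 x) = q0 x.
Hypothesis rad_q0 : rad_trivial q0.

Let q00 : q0 0 = 0.
Proof.
rewrite -p0q (_ : p0 0 = 0) ?quad0 //.
by apply: (addrI (p0 0)); rewrite -p0D !addr0.
Qed.

Lemma polarDr v w w' : polar Q v (w + w') = polar Q v w + polar Q v w'.
Proof. by rewrite -[w]scale1r polarP mul1r scale1r. Qed.

Lemma polar_sumr v (I : finType) (P : pred I) (g : I -> T) :
  (forall i, P i -> polar Q v (g i) = 0) -> polar Q v (\sum_(i | P i) g i) = 0.
Proof.
move=> h; apply: (big_ind (fun w => polar Q v w = 0)) => //.
  exact: polar0r.
by move=> x y hx hy; rewrite polarDr hx hy addr0.
Qed.

Lemma quad_orth_sum (g : 'I_k -> T) : (forall i, g i \in U i) ->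
  Q (\sum_i g i) = \sum_i Q (g i).
Proof.
move=> gU; elim: (index_enum _) (index_enum_uniq 'I_k) => [|i s IHs] /=.
  by rewrite !big_nil quad0.
case/andP=> is_ us; rewrite !big_cons quadD IHs // [polar _ _ _](_ : _ = 0) ?addr0 //.
rewrite big_seq; apply: (big_ind (fun w => polar Q (g i) w = 0)).
- exact: polar0r.
- by move=> x y hx hy; rewrite polarDr hx hy addr0.
- by move=> j js; apply: (orthU (i := i) (j := j)) => //; apply: contraNneq is_ => ->.
Qed.

(** A sum of pairwise orthogonal planes of plus type and of a further summand R,
    itself parametrized by X, is described by coordinates. R will be zero for
    the plus type, the minus plane or the line in the two other cases. *)
Lemma planes_isometric : isometric (orth_sum (k := k) q0) Q.
Proof.
have /fin_all_exists [e eP] : forall i, exists e : T * T, basis_of (U i) [:: e.1; e.2] /\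
    forall v : 'F_2 * 'F_2, Q (v.1 *: e.1 + v.2 *: e.2) = plane_form 0 0 v.
  move=> i; have [e1 [e2 [b h]]] := planeU i; exists (e1, e2); split=> // v.
  by rewrite h /plane_form !mul0r add0r addr0.
pose p i (v : 'F_2 * 'F_2) := v.1 *: (e i).1 + v.2 *: (e i).2.
have spanU i : U i = (<[(e i).1]> + <[(e i).2]>)%VS.
  by have [/span_basis <- _] := eP i; rewrite span_cons span_seq1.
have pU i v : p i v \in U i.
  by rewrite spanU memv_add // rpredZ // memv_line.
have pD i : {morph p i : v w / v + w}.
  by move=> v w; rewrite /p !scalerDl addrACA.
pose phi (w : planes k * X) := \sum_i p i (w.1 i) + p0 w.2.
have phiD : {morph phi : v w / v + w}.
  move=> v w; rewrite /phi p0D addrACA -big_split; congr (_ + _).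
  by apply: eq_bigr => i _; rewrite ffunE pD.
have phiq w : Q (phi w) = orth_sum q0 w.
  rewrite /phi quadD p0q quad_orth_sum // [polar _ _ _](_ : _ = 0).
    rewrite addr0; congr (_ + _); apply: eq_bigr => i _.
    by have [_ ->] := eP i.
  by rewrite polarC; apply: polar_sumr => i _; rewrite polarC; exact: orthR.
have phi_inj : injective phi.
  apply: (isometry_inj phiD phiq); last exact: orth_sum_rad.
  by rewrite /orth_sum hyp_form0 q00 addr0.
have phi_surj v : exists w, phi w == v.
  have : v \in (\sum_i U i + R)%VS by rewrite full memvf.
  case/memv_addP=> u /memv_sumP[g gU ->] [r /p0_surj[x ->] ->].
  have /fin_all_exists [w wP] : forall i, exists w, g i = p i w.
    move=> i; have := gU i isT; rewrite spanU => /memv_addP[_ /vlineP[a ->]].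
    by case=> _ /vlineP[b ->] ->; exists (a, b).
  exists ([ffun i => w i], x); apply/eqP; congr (_ + _).
  by apply: eq_bigr => i _; rewrite ffunE -wP.
exists phi; split=> //; exists (fun v => xchoose (phi_surj v)) => v.
  exact/phi_inj/eqP/(xchooseP (phi_surj (phi v))).
exact/eqP/(xchooseP (phi_surj v)).
Qed.

End PlaneDecomposition.
End Isometries.

(** * The three types of a form with trivial radical *)

Section Types.

Variables (T : vectType 'F_2) (Q : quad_form T).
Hypothesis radQ : rad_quad Q = 0%VS.

Local Notation form0 := (fun _ : {ffun 'I_0 -> 'F_2} => 0 : 'F_2).

Lemma ffun_ord0 (S : nmodType) (x : {ffun 'I_0 -> S}) : x = 0.
Proof. by apply/ffunP => -[]. Qed.

Lemma line_form_rad : rad_trivial line_form.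
Proof. by move=> a _; case: (F2P a) => ->. Qed.

Lemma card_F2 : #|{: 'F_2}| = 2. Proof. by rewrite card_ord. Qed.

Lemma card_planes k : #|{: planes k}| = (2 ^ k.*2)%N.
Proof. by rewrite card_ffun card_prod !card_F2 card_ord -mul2n expnM. Qed.

(** The dimension is obtained by counting vectors. *)
Lemma isometric_dim (W : zmodType) (Y : finType) (b : Y -> W) (q : W -> 'F_2) d :
  bijective b -> #|Y| = (2 ^ d)%N -> isometric q Q -> \dim {:T} = d.
Proof.
move=> bb cY [phi [_ bphi _]]; apply: (@expnI 2) => //; rewrite -cY.
rewrite -{1}(@card_Fp 2 isT).
pose fT : vectType 'F_2 := finvect_type T.
have := @card_vspace _ (finvect_type T) (Vector.class fT) fullv.
rewrite card_vspacef => <-; symmetry.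
by apply: (@bij_eq_card _ (finvect_type T) (phi \o b)); exact: bij_comp.
Qed.

Lemma plus_isometric : plus_type Q ->
  exists2 k, \dim {:T} = k.*2 & isometric (@orth_sum k _ form0) Q.
Proof.
move=> [k [U [[full _ orth] pl]]]; rewrite radQ in full.
suff iso : isometric (@orth_sum k _ form0) Q.
  exists k => //; apply: (isometric_dim (b := @id (planes k * {ffun 'I_0 -> 'F_2})%type)) iso.
    by exists id.
  by rewrite card_prod card_planes card_ffun !card_ord expn0 muln1.
apply: (planes_isometric full pl orth (p0 := fun=> 0)).
- by move=> i v w _; rewrite memv0 => /eqP ->; rewrite polar0r.
- by move=> x y; rewrite addr0.
- by move=> x; exact: mem0v.
- by move=> v; rewrite memv0 => /eqP ->; exists 0.
- by move=> x; rewrite quad0.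
- by move=> v _ _; exact: ffun_ord0.
Qed.

Section OneExceptional.

Variables (k : nat) (U : 'I_k -> {vspace T}) (i0 : 'I_k).
Hypothesis dec : orthogonal_decomposition Q U.
Hypothesis planeU : forall i, i != i0 -> plus_plane Q (U i).
Variables (X : zmodType) (q0 : X -> 'F_2) (p0 : X -> T).
Hypothesis p0D : {morph p0 : x y / x + y}.
Hypothesis p0R : forall x, p0 x \in U i0.
Hypothesis p0_surj : forall v, v \in U i0 -> exists x, v = p0 x.
Hypothesis p0q : forall x, Q (p0 x) = q0 x.
Hypothesis rad_q0 : rad_trivial q0.

(** The planes other than U i0 are numbered by [lift i0]. *)
Lemma exceptional_isometric : isometric (@orth_sum k.-1 _ q0) Q.
Proof.
have [full _ orth] := dec.
have fullU : (\sum_i U (lift i0 i) + U i0 = fullv)%VS.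
  by rewrite addvC -full radQ addv0 [RHS](bigD1_ord i0).
apply: (planes_isometric fullU _ _ _ p0D p0R p0_surj p0q rad_q0) => [i|i j ij|i v w].
- by apply: planeU; rewrite eq_sym neq_lift.
- by apply: orth; rewrite (inj_eq lift_inj).
- by apply: orth; rewrite eq_sym neq_lift.
Qed.

End OneExceptional.

Lemma minus_isometric : minus_type Q ->
  exists2 k, \dim {:T} = k.+1.*2 & isometric (@orth_sum k _ (plane_form 1 1)) Q.
Proof.
move=> [k [U [dec [i0 [[e1 [e2 [b h]]] pl]]]]].
suff iso : isometric (@orth_sum k.-1 _ (plane_form 1 1)) Q.
  exists k.-1 => //; apply: (isometric_dim (b := @id (planes k.-1 * ('F_2 * 'F_2))%type)) iso.
    by exists id.
  by rewrite !card_prod card_planes card_F2 -[(2 * 2)%N]/(2 ^ 2)%N -expnD addn2.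
have spanU : U i0 = (<[e1]> + <[e2]>)%VS.
  by have /span_basis <- := b; rewrite span_cons span_seq1.
apply: (exceptional_isometric dec pl
          (p0 := fun v : 'F_2 * 'F_2 => v.1 *: e1 + v.2 *: e2)).
- by move=> v w; rewrite !scalerDl addrACA.
- by move=> v; rewrite spanU memv_add // rpredZ // memv_line.
- move=> v; rewrite spanU => /memv_addP[_ /vlineP[x ->] [_ /vlineP[y ->] ->]].
  by exists (x, y).
- move=> v; rewrite h /plane_form.
  have sq (x : 'F_2) : x ^+ 2 = x by case: (F2P x) => ->; apply/val_inj.
  by rewrite !sq !mul1r.
- by move=> v /plane_form_nondeg.
Qed.

Lemma zero_isometric : zero_type Q ->
  exists2 k, \dim {:T} = k.*2.+1 & isometric (@orth_sum k _ line_form) Q.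
Proof.
move=> [k [U [dec [i0 [[e b h] pl]]]]].
suff iso : isometric (@orth_sum k.-1 _ line_form) Q.
  exists k.-1 => //; apply: (isometric_dim (b := @id (planes k.-1 * 'F_2)%type)) iso.
    by exists id.
  by rewrite card_prod card_planes card_F2 -expnSr.
have spanU : U i0 = <[e]>%VS by have /span_basis <- := b; rewrite span_seq1.
apply: (exceptional_isometric dec pl (p0 := fun x : 'F_2 => x *: e)) => //.
- by move=> v w; rewrite scalerDl.
- by move=> v; rewrite spanU rpredZ // memv_line.
- by move=> v; rewrite spanU => /vlineP[x ->]; exists x.
- exact: line_form_rad.
Qed.

End Types.

(** * The two radicals *)

Section Radicals.

Variables (V : vectType 'F_2) (Q : quad_form V).
Local Notation rho := (\dim (rad_quad Q)).
Local Notation pi := (quot_pi (rad_quad Q)).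

Lemma rad_quad_quot : rad_quad (quad_quot Q) = 0%VS.
Proof.
apply/eqP; rewrite -subv0; apply/subvP => x /rad_quadP[hx qx].
rewrite memv0 -[x]quot_piK -(raddf0 pi) quot_pi_eq subr0.
apply/rad_quadP; split; last by rewrite -quad_quotE quot_piK.
by move=> w; rewrite -polar_quot quot_piK; exact: hx.
Qed.

(** V is the sum of Rad(Q) and of the image of an additive section of the
    projection to V / Rad(Q), and Q only depends on the component in that image;
    the summand 0 is the form on Rad(Q). *)
Lemma rad_split :
  isometric (fun v : quot_space (rad_quad Q) * {ffun 'I_rho -> 'F_2} =>
               quad_quot Q v.1 + 0) Q.
Proof.
pose U := rad_quad Q.
have dUC : (U^C :&: U = 0)%VS by rewrite capvC capv_compl.
have UCfull x : x \in (U^C + U)%VS by rewrite addvC addv_complf memvf.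
pose p := daddv_pi U^C U.
have pU x : x - p x \in U.
  by rewrite -{1}(daddv_pi_add dUC (UCfull x)) addrAC subrr add0r memv_pi.
have pUC x : p x \in (U^C)%VS by exact: memv_pi.
have p0 x : x \in U -> p x = 0.
  move=> xU; apply/eqP; rewrite -memv0 -dUC memv_cap pUC /=.
  by rewrite -[p x](subKr x) rpredB.
(* The section: the representative is projected to a complement of Rad(Q). *)
pose s (x : quot_space U) := p (repr x).
have sE v : s (pi v) = p v.
  apply/eqP; rewrite -subr_eq0 -linearB; apply/eqP/p0.
  by rewrite -quot_pi_eq quot_piK.
have sD : {morph s : x y / x + y}.
  by move=> x y; rewrite -[x]quot_piK -[y]quot_piK -raddfD !sE raddfD.
have piU v : v \in U -> pi v = 0.
  by move=> vU; apply/eqP; rewrite -(raddf0 pi) quot_pi_eq subr0.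
have piD v w : pi (v + w) = pi v + pi w by exact: raddfD.
have piS x : pi (s x) = x.
  rewrite -{2}[x]quot_piK; apply/eqP; rewrite eq_sym quot_pi_eq; exact: pU.
pose l (c : {ffun 'I_rho -> 'F_2}) : V := \sum_i c i *: (vbasis U)`_i.
have lU c : l c \in U.
  by apply: rpred_sum => i _; rewrite rpredZ // vbasis_mem // mem_nth ?size_tuple.
pose phi (v : quot_space U * {ffun 'I_rho -> 'F_2}) := s v.1 + l v.2.
have piphi v : pi (phi v) = v.1 by rewrite piD piS piU // addr0.
have bU := vbasisP U.
pose psi (v : V) : quot_space U * {ffun 'I_rho -> 'F_2} :=
  (pi v, [ffun i => coord (vbasis U) i (v - s (pi v))]).
exists phi; split=> [v w||v].
- rewrite /phi sD addrACA; congr (_ + _); rewrite /l -big_split.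
  by apply: eq_bigr => i _; rewrite ffunE scalerDl.
- exists psi => [v|v].
    rewrite /psi piphi; case: v => x c; congr (_, _); apply/ffunP => i.
    rewrite ffunE /phi /= addrC addKr.
    by rewrite coord_sum_free // (basis_free bU).
  rewrite /phi /psi /= /l.
  under eq_bigr => i _ do rewrite ffunE.
  rewrite -(coord_basis bU); first by rewrite addrC subrK.
  by rewrite sE; exact: pU.
- by rewrite -quad_quotE piphi addr0.
Qed.

Lemma dim_rad_polar_nondeg : nondegenerate (quad_quot Q) ->
  \dim (rad_polar Q) = rho.
Proof.
move=> nd; congr (\dim _); apply/eqP; rewrite eqEsubv; apply/andP; split.
  apply/subvP => v /rad_polarP h.
  have : pi v = 0.
    by apply: nd => x; rewrite -[x]quot_piK; apply: etrans (h (repr x)); exact: polar_quot.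
  by move/eqP; rewrite -(raddf0 pi) quot_pi_eq subr0.
by apply/subvP => v /rad_quadP[h _]; apply/rad_polarP.
Qed.

(** Rad(f) is spanned by Rad(Q) and a lift e of the vector of the line: e is
    orthogonal to everything, but Q e = 1. *)
Lemma dim_rad_polar_line k :
  isometric (@orth_sum k _ line_form) (quad_quot Q) ->
  \dim (rad_polar Q) = rho.+1.
Proof.
move=> [phi [phiD [psi phiK psiK] qE]].
pose e := repr (phi (0, 1)).
have pe : pi e = phi (0, 1) by exact: quot_piK.
have Qe : Q e = 1.
  rewrite -quad_quotE pe; apply: etrans (qE _) _.
  by rewrite /orth_sum /= hyp_form0; apply/val_inj.
have q00 : line_form 0 = 0 by apply/val_inj.
have polar_line (a b : 'F_2) : polar line_form a b = 0.
  by case: (F2P a) => ->; case: (F2P b) => ->; apply/val_inj.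
have rad_e : e \in rad_polar Q.
  apply/rad_polarP => w; rewrite -polar_quot pe -[pi w]psiK.
  apply: etrans (morph_polar _ _ phiD qE) _.
  by rewrite polar_pair /= polar_line addr0 polar_0l // hyp_form0.
have pi_eq v w : pi v = pi w -> v - w \in rad_quad Q.
  by move/eqP; rewrite quot_pi_eq.
have radE : rad_polar Q = (<[e]> + rad_quad Q)%VS.
  apply/eqP; rewrite eqEsubv; apply/andP; split; last first.
    apply/subvP => _ /memv_addP[_ /vlineP[a ->] [v /rad_quadP[hv _] ->]].
    by rewrite rpredD ?rpredZ //; apply/rad_polarP.
  apply/subvP => v /rad_polarP hv; case E: (psi (pi v)) => [w z].
  have [|/= w0 _] := orth_sum_polar_rad q00 (v := (w, z)).
    move=> u; rewrite -(morph_polar _ _ phiD qE) -E psiK -[phi u]quot_piK.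
    by apply: etrans (hv (repr (phi u))); exact: polar_quot.
  have pv : pi v = phi (0, z) by rewrite -w0 -E psiK.
  case: (F2P z) pv => -> pv.
    apply: (subvP (addvSr _ _)); rewrite -[v]subr0; apply: pi_eq.
    rewrite pv raddf0; apply: (addrI (phi (0, 0))).
    by rewrite -phiD !addr0.
  rewrite -[v](subrK e) addrC memv_add ?memv_line //.
  by apply: pi_eq; rewrite pe.
have ne : e \notin rad_quad Q.
  by apply/negP => /rad_quadP[_]; rewrite Qe.
rewrite radE dimv_disjoint_sum ?dim_vline.
  by case: eqP ne => // ->; rewrite mem0v.
apply/eqP; rewrite -subv0; apply/subvP => x; rewrite memv_cap memv0.
case/andP=> /vlineP[a ->]; case: (F2P a) => ->; first by rewrite scale0r.
by rewrite scale1r (negPf ne).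
Qed.

End Radicals.

(** * Models of a quadratic space *)

Section CliffordModels.

Variables (F : fieldType).
Hypothesis two_neq0 : (2%:R : F) != 0.

Lemma plus_model k :
  has_model (@orth_sum k _ (fun _ : {ffun 'I_0 -> 'F_2} => 0)) (tensor_pow (M2 F) k).
Proof.
apply: has_model_isometric (tensor_pow_M2 two_neq0 k).
exists (fun w => (w, 0)); split=> [v w||v]; last by rewrite /orth_sum addr0.
  by congr (_, _); rewrite addr0.
by exists fst => // -[w x]; congr (_, _); rewrite [x]ffun_ord0.
Qed.

Lemma minus_model_split k (x y : F) : x ^+ 2 + y ^+ 2 = -1 ->
  has_model (@orth_sum k _ (plane_form 1 1)) (tensor_pow (M2 F) k.+1).
Proof.
move=> xy; have tk := tensor_pow_M2 two_neq0 k.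
apply: has_model_isometric (has_model_tensor (M2_minus two_neq0 xy) tk).
exists (fun v => (v.2, v.1)); split=> [//||v]; last by rewrite /orth_sum addrC.
by exists (fun v => (v.2, v.1)) => -[].
Qed.

Lemma minus_model_quaternion k :
  has_model (@orth_sum k _ (plane_form 1 1))
    (tensor (tensor_pow (M2 F) k) (quaternion F)).
Proof. exact: has_model_tensor (tensor_pow_M2 two_neq0 k) (quaternion_model two_neq0). Qed.

Lemma zero_model_adjoin k :
  has_model (@orth_sum k _ line_form)
    (tensor (tensor_pow (M2 F) k) (adjoin_i F)).
Proof. exact: has_model_tensor (tensor_pow_M2 two_neq0 k) (adjoin_i_model F). Qed.

Variables (V : vectType 'F_2) (Q : quad_form V).
Local Notation rho := (\dim (rad_quad Q)).

Lemma rad_model A :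
  has_model (quad_quot Q) A -> has_model Q (direct_pow (2 ^ rho) A : pzAlgType F).
Proof.
move=> mA; apply: has_model_isometric (rad_split Q) _.
apply: (has_model_direct_pow two_neq0 (l := fun=> 1) (q' := fun=> 0)) mA => [c d|c].
  by rewrite mulr1; exact: eqpm_refl.
by rewrite mulr1.
Qed.

(** In the presence of i with i^2 = -1 the exceptional line contributes the
    scalar factor i, and its coordinate joins those of the radical. *)
Lemma zero_model_split k (i : F) : i ^+ 2 = -1 ->
  isometric (@orth_sum k _ line_form) (quad_quot Q) ->
  has_model Q (direct_pow (2 ^ rho.+1) (tensor_pow (M2 F) k)).
Proof.
move=> ii [phi [phiD [psi phiK psiK] qE]].
pose l (c : {ffun 'I_rho.+1 -> 'F_2}) : F := i ^+ c ord0.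
have l_mul c d : eqpm (l c * l d) (l (c + d)).
  rewrite /l ffunE; case: (F2P (c ord0)) => ->; first by rewrite mul1r add0r; left.
  case: (F2P (d ord0)) => ->; first by rewrite mulr1 addr0; left.
  by right; rewrite /= -expr2 ii.
have l_sqr c : l c * l c = (-1) ^+ (c ord0 ^+ 2)%R.
  rewrite /l; case: (F2P (c ord0)) => ->; first by rewrite mul1r.
  by rewrite /= expr1 -expr2 ii.
apply: has_model_isometric (rad_split Q) _.
have := has_model_direct_pow two_neq0 l_mul l_sqr (tensor_pow_M2 two_neq0 k).
apply: has_model_isometric.
pose f (v : planes k * {ffun 'I_rho.+1 -> 'F_2}) :
    quot_space (rad_quad Q) * {ffun 'I_rho -> 'F_2} :=
  (phi (v.1, (ffun_split v.2).1), (ffun_split v.2).2).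
pose g (u : quot_space (rad_quad Q) * {ffun 'I_rho -> 'F_2}) :
    planes k * {ffun 'I_rho.+1 -> 'F_2} :=
  ((psi u.1).1, ffun_join ((psi u.1).2, u.2)).
exists f; split.
- by move=> v w; rewrite /f ffun_splitD; congr (_, _); rewrite -phiD.
- exists g => [[w c]|[x c]]; first by rewrite /f /g phiK; congr (_, _); exact: ffun_splitK.
  by rewrite /f /g; cbn [fst snd]; rewrite ffun_joinK /= -surjective_pairing psiK.
- by move=> v; rewrite /= addr0; exact: qE.
Qed.

End CliffordModels.

(** * The isomorphism type *)

Theorem proposition5p3 (V : vectType 'F_2) (Q : quad_form V)
    (F : fieldType) (X : (\dim {:V}).-tuple V) :
  {:V}%VS != 0%VS ->
  2%N \notin [pchar F] ->
  basis_of {:V} X ->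
  let Qbar := quad_quot Q in
  let n := \dim {: quot_space (rad_quad Q)} in
  let r := \dim (rad_polar Q) in
  let C := quasi_clifford F Q X in
  [/\ field_type_I F ->
        (~~ odd n -> plus_type Qbar \/ minus_type Qbar ->
           alg_isom C (direct_pow (2 ^ r) (tensor_pow (M2 F) n./2))) /\
        (odd n -> zero_type Qbar ->
           alg_isom C (direct_pow (2 ^ r) (tensor_pow (M2 F) (n - 1)./2))),
      field_type_II F ->
        (~~ odd n -> plus_type Qbar \/ minus_type Qbar ->
           alg_isom C (direct_pow (2 ^ r) (tensor_pow (M2 F) n./2))) /\
        (odd n -> zero_type Qbar ->
           alg_isom C (direct_pow (2 ^ (r - 1))
             (tensor (tensor_pow (M2 F) (n - 1)./2) (adjoin_i F)))) &
      field_type_III F ->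
        [/\ ~~ odd n -> plus_type Qbar ->
              alg_isom C (direct_pow (2 ^ r) (tensor_pow (M2 F) n./2)),
            ~~ odd n -> minus_type Qbar ->
              alg_isom C (direct_pow (2 ^ r)
                (tensor (tensor_pow (M2 F) (n - 2)./2) (quaternion F))) &
            odd n -> zero_type Qbar ->
              alg_isom C (direct_pow (2 ^ (r - 1))
                (tensor (tensor_pow (M2 F) (n - 1)./2) (adjoin_i F)))]].
Proof.
move=> _ char2 basisX Qbar n r C.
have two_neq0 : (2%:R : F) != 0 by move: char2; rewrite inE.
have radQ : rad_quad Qbar = 0%VS := rad_quad_quot Q.
have isom A : has_model Q A -> alg_isom C A := quasi_clifford_isom basisX (A := A).
have minus_r : forall k, isometric (@orth_sum k _ (plane_form 1 1)) Qbar ->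
    r = \dim (rad_quad Q).
  move=> k iso; apply/dim_rad_polar_nondeg/(isometric_nondeg iso).
  by apply: orth_sum_nondeg; [exact/val_inj | exact: plane_form_nondeg].
have plus : plus_type Qbar ->
    alg_isom C (direct_pow (2 ^ r) (tensor_pow (M2 F) n./2)).
  move=> /(plus_isometric radQ)[k nE iso]; apply: isom.
  have -> : r = \dim (rad_quad Q).
    apply/dim_rad_polar_nondeg/(isometric_nondeg iso).
    by apply: orth_sum_nondeg => // v _; exact: ffun_ord0.
  rewrite [n]nE doubleK; apply: rad_model => //.
  exact/(has_model_isometric iso)/plus_model.
have minus_split x y : x ^+ 2 + y ^+ 2 = -1 :> F -> minus_type Qbar ->
    alg_isom C (direct_pow (2 ^ r) (tensor_pow (M2 F) n./2)).
  move=> xy /(minus_isometric radQ)[k nE iso]; apply: isom.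
  rewrite (minus_r k iso) [n]nE doubleK; apply: rad_model => //.
  exact/(has_model_isometric iso)/(minus_model_split two_neq0 _ xy).
have minus_quaternion : minus_type Qbar -> alg_isom C
    (direct_pow (2 ^ r) (tensor (tensor_pow (M2 F) (n - 2)./2) (quaternion F))).
  move=> /(minus_isometric radQ)[k nE iso]; apply: isom.
  rewrite (minus_r k iso) [n]nE doubleS subn2 doubleK; apply: rad_model => //.
  exact/(has_model_isometric iso)/minus_model_quaternion.
have zero_split i : i ^+ 2 = -1 :> F -> zero_type Qbar ->
    alg_isom C (direct_pow (2 ^ r) (tensor_pow (M2 F) (n - 1)./2)).
  move=> ii /(zero_isometric radQ)[k nE iso]; apply: isom.
  rewrite /r (dim_rad_polar_line iso) [n]nE subn1 doubleK.
  exact: zero_model_split ii iso.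
have zero_adjoin : zero_type Qbar -> alg_isom C
    (direct_pow (2 ^ (r - 1)) (tensor (tensor_pow (M2 F) (n - 1)./2) (adjoin_i F))).
  move=> /(zero_isometric radQ)[k nE iso]; apply: isom.
  rewrite /r (dim_rad_polar_line iso) [n]nE !subn1 doubleK; apply: rad_model => //.
  exact/(has_model_isometric iso)/zero_model_adjoin.
split=> [[i ii]|[_ [x [y xy]]]|_].
- split=> [_ [|] |_]; [exact: plus | | exact: zero_split ii].
  (* Type I is the case y = 0 of the equation x^2 + y^2 = -1. *)
  by apply: (minus_split i 0); rewrite expr0n addr0.
- split=> [_ [|] |_]; [exact: plus | exact: minus_split xy | exact: zero_adjoin].
- by split=> _; [exact: plus | exact: minus_quaternion | exact: zero_adjoin].
Qed.
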